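(* Assume $\psi_1>0$ and $\psi_2<0$. For $x_m\in\mathbb{R}$ and $u_m<0$ let $(x(\psi),y(\psi))$, $\psi\in[\psi_2,\psi_1]$, be the solution of $$\frac{dx}{d\psi}=\sigma\frac{\cos\psi}{gy},\qquad \frac{dy}{d\psi}=\sigma\frac{\sin\psi}{gy},\qquad x(0)=x_m,\quad y(0)=u_m=\sup_{\psi_2\le\psi\le\psi_1}y(\psi).$$ If this curve meets the two walls with slope angles $\psi_1$ (left wall) and $\psi_2$ (right wall), then the enclosed volume $\mathcal{V}$ and the $y$-coordinate $-P_0/g$ of the intersection point $O$ of the walls can be represented as functions of $u_m$ alone. Moreover $$\lim_{u_m\to 0^-}\mathcal{V}(u_m)=+\infty,\qquad \lim_{u_m\to-\infty}\mathcal{V}(u_m)=0 .$$ Consequently, for any prescribed $V>0$ there exist at least one $u_m$ and a corresponding solution $(x(\psi),y(\psi))$, $\psi\in[\psi_2,\psi_1]$, of the system $\frac{dx}{d\psi}=\sigma\frac{\cos\psi}{gy}$, $\frac{dy}{d\psi}=\sigma\frac{\sin\psi}{gy}$ with $x(0)=x_m$, $y(0)=u_m=\sup_{\psi_2\le\psi\le\psi_1}y(\psi)$ (meeting the walls with slope angles $\psi_1,\psi_2$) such that $\mathcal{V}(u_m)=V$. Furthermore, if $[\![\gamma]\!]<0$, then $\mathcal{V}(u_m)$ is a strictly increasing function of $u_m$; as a result, for any given $V>0$ the choice of $u_m$ and of the solution satisfying $\mathcal{V}(u_m)=V$ is unique when $[\![\gamma]\!]<0$.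
   Context: Let $g>0$, $\sigma>0$, $\theta_1,\theta_2\in(0,\pi)$ with $\theta_1+\theta_2<\pi$, and $[\![\gamma]\!]\in\mathbb{R}$ with $-1\le[\![\gamma]\!]/\sigma\le1$. Define $\gamma\in[-\frac\pi2,\frac\pi2]$ by $\sin\gamma=-[\![\gamma]\!]/\sigma$, and $\psi_1:=\gamma+\frac\pi2-\theta_1$, $\psi_2:=-\gamma-\frac\pi2+\theta_2$. The walls are two rays issuing from a point $O=(0,-P_0/g)$, where $P_0\in\mathbb{R}$ is not prescribed in advance: the left wall is $O+\{t(-\cos\theta_1,\sin\theta_1):t\ge0\}$ and the right wall is $O+\{t(\cos\theta_2,\sin\theta_2):t\ge 0\}$. The curve ''meets the walls with slope angles $\psi_1$ and $\psi_2$'' means that $(x(\psi_1),y(\psi_1))$ lies on the left wall and $(x(\psi_2),y(\psi_2))$ lies on the right wall. $\mathcal{V}$ denotes the area of the region enclosed by the curve and the two walls (the wall segments from $O$ to the two contact points). *)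

(* Defs.v *)
From HB Require Import structures.
From mathcomp Require Import all_boot all_order all_algebra.
From mathcomp Require Import all_classical all_reals all_analysis.

Set Implicit Arguments.
Unset Strict Implicit.
Unset Printing Implicit Defensive.

Import Order.TTheory GRing.Theory Num.Theory.
Import numFieldNormedType.Exports.

Local Open Scope classical_set_scope.
Local Open Scope ring_scope.

(* Plane sets are subsets of R * R, first component horizontal, second
   component vertical (pointing upwards). *)

Definition plane_area (R : realType) (A : set (R * R)) : \bar R :=
  ((@lebesgue_measure R) \x (@lebesgue_measure R))%E A.

(* The points off C whose connected component in the complement of C is
   bounded: for a Jordan curve C, its interior. *)
Definition enclosed (R : realType) (C : set (R * R)) : set (R * R) :=
  [set p | ~ C p /\ bounded_set (connected_component (~` C) p)].

Definition line_segment (R : realType) (a b : R * R) : set (R * R) :=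
  [set a + t *: (b - a) | t in `[0, 1]].

Section Drop.
Context {R : realType}.

Definition psi_left (gamma theta1 : R) : R := gamma + pi / 2 - theta1.

Definition psi_right (gamma theta2 : R) : R := - gamma - pi / 2 + theta2.

Definition vertex (g P0 : R) : R * R := (0, - P0 / g).

Definition left_wall (g P0 theta1 : R) : set (R * R) :=
  [set vertex g P0 + t *: (- cos theta1, sin theta1) | t in `[0, +oo[].

Definition right_wall (g P0 theta2 : R) : set (R * R) :=
  [set vertex g P0 + t *: (cos theta2, sin theta2) | t in `[0, +oo[].

(* The condition um < 0 together with um = sup y keeps y away from 0, so the
   division by g * y psi is a genuine one. At the end points of the interval
   only continuity is required; the one-sided derivatives there then exist and
   satisfy the equations, the right-hand sides being continuous. *)
Definition capillary_solution (g sigma psi1 psi2 xm um : R) (x y : R -> R) : Prop :=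
  [/\ {within `[psi2, psi1], continuous x},
      {within `[psi2, psi1], continuous y},
      forall psi, psi2 < psi < psi1 ->
        is_derive psi 1 x (sigma * cos psi / (g * y psi)) /\
        is_derive psi 1 y (sigma * sin psi / (g * y psi)),
      x 0 = xm
    & y 0 = um /\ um = sup [set y psi | psi in `[psi2, psi1]] ].

Definition meets_walls (g theta1 theta2 psi1 psi2 P0 : R) (x y : R -> R) : Prop :=
  left_wall g P0 theta1 (x psi1, y psi1) /\
  right_wall g P0 theta2 (x psi2, y psi2).

Definition capillary_drop (g sigma gamma theta1 theta2 xm um P0 : R)
    (x y : R -> R) : Prop :=
  let psi1 := psi_left gamma theta1 in
  let psi2 := psi_right gamma theta2 in
  [/\ um < 0,
      capillary_solution g sigma psi1 psi2 xm um x y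
    & meets_walls g theta1 theta2 psi1 psi2 P0 x y].

Definition drop_boundary (g gamma theta1 theta2 P0 : R) (x y : R -> R) :
    set (R * R) :=
  let psi1 := psi_left gamma theta1 in
  let psi2 := psi_right gamma theta2 in
  [set (x psi, y psi) | psi in `[psi2, psi1]]
  `|` line_segment (vertex g P0) (x psi1, y psi1)
  `|` line_segment (vertex g P0) (x psi2, y psi2).

Definition drop_volume (g gamma theta1 theta2 P0 : R) (x y : R -> R) : \bar R :=
  plane_area (enclosed (drop_boundary g gamma theta1 theta2 P0 x y)).

End Drop.

(* Main.v *)
Require Import Defs.
From HB Require Import structures.
From mathcomp Require Import all_boot all_order all_algebra.
From mathcomp Require Import all_classical all_reals all_analysis.
From mathcomp Require Import measurable_realfun ring lra.
Import Order.TTheory GRing.Theory Num.Theory.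
Import numFieldNormedType.Exports.
Local Open Scope classical_set_scope.
Local Open Scope ring_scope.

Set Implicit Arguments.
Unset Strict Implicit.
Unset Printing Implicit Defensive.

(* The first integral of the equations gives y explicitly and x up to a
   translation; the two walls then fix the translation and the vertex O, so um
   determines the drop. Sliced horizontally, the enclosed region lies between
   two graphs that meet only at O and at the bottom point, which identifies the
   bounded component of the complement of the boundary and, with Fubini and the
   fundamental theorem of calculus, its area.

   Let h(psi) be the distance from O to the tangent line of slope psi and
   r(psi) = sigma / (g |y|) the radius of curvature. Twice the area is the
   integral of h r, and since drops with different um share the wall
   directions, the mixed integrals of h_u r_v and h_v r_u agree. Hence
   2 (V u - V v) is the integral of (h_u + h_v) (r_u - r_v). As h > 0 and r
   increases with um, V is strictly increasing; the bound h = O(1 / |um|) gives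
   continuity and the limit 0, and the logarithmic divergence of the integral
   of r gives the limit +oo. *)

(** * Regions between two graphs *)

Section RegionBetweenGraphs.
Context {R : realType}.
Implicit Types (C D G K : set (R * R)).

(** The contact slopes may exceed a right angle, so the curve can overhang: abscissas are not
    monotone along it, and neither the positivity of h nor the fact that the two graphs do not cross
    is visible from the formulas. What replaces monotonicity is [tilt], the coordinate of the curve
    in a fixed direction: its derivative [radius * sin (phi - psi)] makes it rise up to [psi = phi]
    and fall afterwards, and since the radius is largest at slope 0 the fall does not outweigh the
    rise over an arc of the same length. For the normal of a wall or of a tangent line it measures
    the distance to that line.

    The mixed integrals are mixed areas, and their symmetry is an integration by parts whose
    boundary terms vanish at the contact points and cancel between the two halves at slope 0.
    Monotonicity thus becomes a pointwise statement, with no comparison of h_u and h_v. The same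
    identity with v fixed at -1 yields the logarithm: there h_v has a positive lower bound near
    slope 0, and only the sign of h_u is used. *)

Lemma connected_component_sub_clopen {T : topologicalType} (A G K : set T) (p : T) :
  open G -> closed K -> A `&` K `<=` G -> G `<=` A -> G `<=` K -> G p ->
  connected_component A p `<=` G.
Proof.
move=> oG cK AKG GA GK Gp.
have cA := @component_connected _ A p.
have sA := @connected_component_sub _ A p.
have Ap : connected_component A p p by apply: connected_component_refl; exact: GA.
(* The traces of [G] and [K] on [A] coincide, so [G] cuts out of the component a nonempty piece that
   is both relatively open and relatively closed. *)
suff E : connected_component A p `&` G = connected_component A p by rewrite -E; exact: subIsetr.
apply: cA; first by exists p; split.
- by exists G.
- exists K => //; apply/seteqP; split => q [Aq].
  + by move=> Gq; split=> //; exact: GK.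
  + by move=> Kq; split=> //; apply: AKG; split => //; exact: sA.
Qed.

(** The factor [s] serves both directions of escape: [1] to the right, [-1] to the left. *)
Lemma horizontal_halfline_connected (s a h : R) :
  connected [set (s * x, h) | x in `[a, +oo[].
Proof.
have -> : [set (s * x, h) | x in `[a, +oo[] = (fun x : R => (s * x, h)) @` `[a, +oo[%classic by [].
apply: connected_continuous_connected.
  by apply/connected_intervalP; exact: interval_is_interval.
apply: continuous_subspaceT => x.
have h1 : (fun y : R => s * y) @ x --> s * x by apply: cvgM; [exact: cvg_cst|exact: cvg_id].
have h2 : (fun=> h : R) @ x --> h by exact: cvg_cst.
exact: (cvg_pair h1 h2).
Qed.

Lemma horizontal_halfline_unbounded (s a h : R) D :
  `|s| = 1 -> [set (s * x, h) | x in `[a, +oo[] `<=` D -> ~ bounded_set D.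
Proof.
move=> s1 sD [M [_ /(_ (Num.max `|a| `|M| + 1))]].
have lM : M < Num.max `|a| `|M| + 1.
  rewrite (le_lt_trans (ler_norm M))// ltr_pwDr//.
  by rewrite le_max lexx orbT.
move=> /(_ lM) H.
pose x : R := Num.max `|a| `|M| + 2.
have ax : a <= x.
  rewrite (le_trans (ler_norm a))// /x.
  rewrite (@le_trans _ _ (Num.max `|a| `|M|)) ?lerDl//.
  by rewrite le_max lexx.
have Dx : D (s * x, h) by apply: sD; exists x => //=; rewrite in_itv/= ax.
have := H _ Dx.
rewrite /= prod_normE/= ge_max => /andP[+ _].
rewrite normrM s1 mul1r ger0_norm; last first.
  by rewrite /x addr_ge0// le_max normr_ge0.
by rewrite /x; lra.
Qed.

Variables (f g : R -> R) (a b : R).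
Hypotheses (cf : continuous f) (cg : continuous g) (ab : a < b).
Hypotheses (fa : f a = g a) (fb : f b = g b).
Hypothesis fg : forall h, a < h < b -> f h < g h.

Definition graphs_boundary : set (R * R) :=
  [set p | a <= p.2 <= b /\ (p.1 = f p.2 \/ p.1 = g p.2)].

Definition graphs_interior : set (R * R) :=
  [set p | a < p.2 < b /\ f p.2 < p.1 < g p.2].

Definition graphs_closed : set (R * R) :=
  [set p | a <= p.2 <= b /\ f p.2 <= p.1 <= g p.2].

Lemma fg_le h : a <= h <= b -> f h <= g h.
Proof.
move=> /andP[]; rewrite le_eqVlt => /orP[/eqP<-|ah]; first by rewrite fa.
rewrite le_eqVlt => /orP[/eqP->|hb]; first by rewrite fb.
by apply/ltW/fg; rewrite ah.
Qed.

Let c1 (F : R -> R) : continuous F ->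
  continuous (fun p : R * R => p.1 - F p.2).
Proof.
move=> cF p; apply: cvgB; first exact: cvg_fst.
by apply: continuous_comp; [exact: cvg_snd|exact: cF].
Qed.

Lemma open_graphs_interior : open graphs_interior.
Proof.
have -> : graphs_interior = (snd @^-1` [set h | a < h]) `&` (snd @^-1` [set h | h < b])
  `&` ((fun p : R * R => p.1 - f p.2) @^-1` [set h | 0 < h])
  `&` ((fun p : R * R => p.1 - g p.2) @^-1` [set h | h < 0]).
  apply/seteqP; split=> p /=; rewrite subr_gt0 subr_lt0.
    by move=> [/andP[? ?] /andP[? ?]].
  by move=> [[[H1 H2] H3] H4]; split; apply/andP.
do 3 ?[apply: openI].
- by apply: open_comp; [move=> ? _; exact: cvg_snd|exact: open_gt].
- by apply: open_comp; [move=> ? _; exact: cvg_snd|exact: open_lt].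
- by apply: open_comp; [move=> ? _; exact: c1|exact: open_gt].
- by apply: open_comp; [move=> ? _; exact: c1|exact: open_lt].
Qed.

Lemma closed_graphs_closed : closed graphs_closed.
Proof.
have -> : graphs_closed = (snd @^-1` [set h | a <= h]) `&` (snd @^-1` [set h | h <= b])
  `&` ((fun p : R * R => p.1 - f p.2) @^-1` [set h | 0 <= h])
  `&` ((fun p : R * R => p.1 - g p.2) @^-1` [set h | h <= 0]).
  apply/seteqP; split=> p /=; rewrite subr_ge0 subr_le0.
    by move=> [/andP[? ?] /andP[? ?]].
  by move=> [[[H1 H2] H3] H4]; split; apply/andP.
do 3 ?[apply: closedI].
- by apply: (continuous_closedP _).1; [move=> p; exact: cvg_snd|exact: closed_ge].
- by apply: (continuous_closedP _).1; [move=> p; exact: cvg_snd|exact: closed_le].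
- by apply: (continuous_closedP _).1; [exact: c1|exact: closed_ge].
- by apply: (continuous_closedP _).1; [exact: c1|exact: closed_le].
Qed.

Lemma bounded_graphs_interior : bounded_set graphs_interior.
Proof.
have bd (F : R -> R) : continuous F -> exists M : R, forall h, a <= h <= b -> `|F h| <= M.
  move=> cF.
  have cnF : {within `[a, b], continuous (fun h => `|F h|)}.
    by apply: continuous_subspaceT => x; apply: cvg_norm; exact: cF.
  have [c _ Hc] := EVT_max (ltW ab) cnF.
  by exists `|F c| => h hab; apply: Hc; rewrite in_itv.
have [Mf Hf] := bd _ cf.
have [Mg Hg] := bd _ cg.
exists (Num.max (Num.max Mf Mg) (Num.max `|a| `|b|)); split; first exact: num_real.
move=> M HM [px py] [/= /andP[ap pb] /andP[fp pg]].
have hab : a <= py <= b by rewrite !ltW.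
move: HM; rewrite !gt_max => /andP[/andP[Mf' Mg'] /andP[Ma Mb]].
move: (Hf _ hab) (Hg _ hab); rewrite !ler_norml => /andP[? ?] /andP[? ?].
move: Ma Mb; rewrite !ltr_norml => /andP[? ?] /andP[? ?].
have Hx : `|px| <= M by rewrite ler_norml; apply/andP; split; lra.
have Hy : `|py| <= M by rewrite ler_norml; apply/andP; split; lra.
by rewrite prod_normE/= ge_max; apply/andP; split.
Qed.

(** A point off the boundary and outside the region escapes along a horizontal half-line. A point
    inside cannot leave, because off the boundary the open region coincides with the closed one. *)
Lemma enclosed_graphs_boundary : enclosed graphs_boundary = graphs_interior.
Proof.
have GC : graphs_interior `<=` ~` graphs_boundary.
  by move=> p /= [_ /andP[fp pg]] [_ [E|E]]; lra.
apply/seteqP; split => p /=.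
- move=> [Cp bp]; apply: contrapT => Gp.
  have big (s x : R) : `|s| = 1 -> p = (s * x, p.2) ->
      [set (s * x, p.2) | x in `[x, +oo[] `<=` ~` graphs_boundary -> False.
    move=> s1 pE sC; apply: (@horizontal_halfline_unbounded s x p.2 _ s1 _ bp).
    apply: connected_component_max => //; first by exists x => //=; rewrite in_itv/= lexx.
    exact: horizontal_halfline_connected.
  have [hab|hab] := boolP (a <= p.2 <= b); last first.
    apply: (big 1 p.1); rewrite ?normr1 ?mul1r//; first by case: (p).
    by move=> _ [x _ <-] /= []; rewrite (negbTE hab).
  have [gp|pg] := ltP (g p.2) p.1.
    apply: (big 1 p.1); rewrite ?normr1 ?mul1r//; first by case: (p).
    move=> _ [x /= + <-] /= [_]; rewrite in_itv/= andbT mul1r => px.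
    by have := fg_le hab => ? [E|E]; lra.
  have [pf|fp] := ltP p.1 (f p.2).
    apply: (big (-1) (- p.1)); rewrite ?normrN ?normr1 ?mulrNN ?mul1r//; first by case: (p).
    move=> _ [x /= + <-] /= [_]; rewrite in_itv/= andbT mulN1r => px.
    by have := fg_le hab => ? [E|E]; lra.
  move: fp; rewrite le_eqVlt => /orP[/eqP fp|fp].
    by apply: Cp; split => //; left.
  move: pg; rewrite le_eqVlt => /orP[/eqP pg|pg].
    by apply: Cp; split => //; right.
  apply: Gp; split; last by rewrite fp.
  (* At the two extreme heights the graphs meet, which leaves no room strictly between them. *)
  move: hab => /andP[]; rewrite le_eqVlt => /orP[/eqP ap|ap].
    by move: fp pg; rewrite -ap fa => ? ?; lra.
  rewrite le_eqVlt => /orP[/eqP bp'|->]; last by rewrite ap.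
  by move: fp pg; rewrite bp' fb => ? ?; lra.
- move=> Gp; split; first exact: GC.
  apply: sub_boundedr bounded_graphs_interior; move=> P GP q Cq; apply: GP; move: q Cq.
  apply: (@connected_component_sub_clopen _ _ _ graphs_closed).
  + exact: open_graphs_interior.
  + exact: closed_graphs_closed.
  + move=> q [Cq [hq /andP[fq qg]]].
    move: fq; rewrite le_eqVlt => /orP[/eqP fq|fq].
      by exfalso; apply: Cq; split => //; left.
    move: qg; rewrite le_eqVlt => /orP[/eqP qg|qg].
      by exfalso; apply: Cq; split => //; right.
    split; last by rewrite fq.
    move: hq => /andP[]; rewrite le_eqVlt => /orP[/eqP ap|ap].
      by move: fq qg; rewrite -ap fa => ? ?; lra.
    rewrite le_eqVlt => /orP[/eqP bp'|->]; last by rewrite ap.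
    by move: fq qg; rewrite bp' fb => ? ?; lra.
  + exact: GC.
  + by move=> q [/andP[? ?] /andP[? ?]]; split; rewrite !ltW.
  + exact: Gp.
Qed.

Let measurable_graphs_interior : measurable graphs_interior.
Proof.
have mc (F : R -> R) : continuous F ->
    measurable_fun [set: R * R] (fun p : R * R => p.1 - F p.2).
  move=> cF; apply: measurable_funB; first exact: measurable_fst.
  apply: (@measurableT_comp _ _ _ _ _ _ F _ snd).
    exact: continuous_measurable_fun.
  exact: measurable_snd.
have -> : graphs_interior = ([set: R * R] `&` (snd @^-1` `]a, b[))
  `&` ([set: R * R] `&` ((fun p : R * R => p.1 - f p.2) @^-1` `]0, +oo[))
  `&` ([set: R * R] `&` ((fun p : R * R => p.1 - g p.2) @^-1` `]-oo, 0[)).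
  apply/seteqP; split=> p /=; rewrite !in_itv/= ?andbT subr_gt0 subr_lt0.
    by move=> [? /andP[? ?]].
  by move=> [[[_ ?] [_ ?]] [_ ?]]; split=> //; apply/andP.
apply: measurableI; first apply: measurableI.
- exact: measurable_snd.
- exact: mc.
- exact: mc.
Qed.

Lemma area_graphs_interior : plane_area graphs_interior =
  (\int[lebesgue_measure]_(h in `[a, b]) (g h - f h)%:E)%E.
Proof.
rewrite /plane_area.
(* Slicing at fixed height integrates in the other order; uniqueness of the product measure
   identifies the two iterated measures. *)
transitivity ((lebesgue_measure \x^ lebesgue_measure)%E graphs_interior).
  apply: (@product_measure_unique _ _ _ _ _ lebesgue_measure lebesgue_measure) => // A B mA mB.
  exact: product_measure2E.
rewrite /product_measure2 /=.
rewrite [RHS]integral_mkcond; apply: eq_integral => h _ /=.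
rewrite patchE; case: ifPn => [/set_mem/= hab|hab]; [rewrite in_itv/= in hab|].
- have -> : ysection graphs_interior h = if (a < h < b) then `]f h, g h[%classic else set0.
    apply/seteqP; split => x; rewrite /ysection/= inE/=.
      by move=> -[/= -> ?]; rewrite /= in_itv.
    by case: ifPn => //= ?; rewrite in_itv.
  have := fg_le hab.
  have [abh _|] := boolP (a < h < b).
    rewrite lebesgue_measure_itv/= lte_fin fg//.
  rewrite negb_and -!leNgt => H _; rewrite measure0.
  have : h = a \/ h = b by move/andP: hab => [? ?]; move/orP: H => [?|?]; [left|right]; lra.
  by move=> [->|->]; rewrite ?fa ?fb subrr.
- have -> : ysection graphs_interior h = set0; last by rewrite measure0.
  apply/seteqP; split => x //; rewrite /ysection/= inE/= => -[/= /andP[? ?] _].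
  by move/negP: hab; apply; apply/mem_set; rewrite /= in_itv/= !ltW.
Qed.

End RegionBetweenGraphs.

(** * Derivatives and primitives of real functions *)

Section RealDerivatives.
Context {R : realType}.
Implicit Types (f g F G : R -> R) (a b x : R).

Lemma is_derive1_fctD f g x a b : is_derive x 1 f a -> is_derive x 1 g b ->
  is_derive x 1 (fun t => f t + g t) (a + b).
Proof. by move=> ? ?; exact: is_deriveD. Qed.

Lemma is_derive1_fctB f g x a b : is_derive x 1 f a -> is_derive x 1 g b ->
  is_derive x 1 (fun t => f t - g t) (a - b).
Proof. by move=> ? ?; exact: is_deriveB. Qed.

Lemma is_derive1_fctN f x a : is_derive x 1 f a ->
  is_derive x 1 (fun t => - f t) (- a).
Proof. by move=> ?; exact: is_deriveN. Qed.

Lemma is_derive1_fctM f g x a b : is_derive x 1 f a -> is_derive x 1 g b ->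
  is_derive x 1 (fun t => f t * g t) (a * g x + f x * b).
Proof.
move=> df dg; have H : is_derive x 1 (f * g) (f x *: b + g x *: a) by exact: is_deriveM.
by apply: (is_derive_eq H); rewrite /GRing.scale/=; ring.
Qed.

Lemma is_derive1_fct_comp f g x a b : is_derive x 1 g b -> is_derive (g x) 1 f a ->
  is_derive x 1 (fun t => f (g t)) (a * b).
Proof. by move=> ? ?; exact: is_derive1_comp. Qed.

Lemma is_derive1_fct_cst (c : R) x : is_derive x 1 (fun=> c) 0.
Proof. exact: is_derive_cst. Qed.

Lemma is_derive1_fct_id x : is_derive x 1 (fun t => t) 1.
Proof. exact: is_derive_id. Qed.

Lemma is_derive1_continuous f x a : is_derive x 1 f a -> {for x, continuous f}.
Proof. by move=> [df _]; apply/differentiable_continuous/derivable1_diffP. Qed.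

Lemma is_derive_within_continuous F f a b :
  (forall x, a <= x <= b -> is_derive x 1 F (f x)) ->
  {within `[a, b], continuous F}.
Proof.
move=> dF; apply: continuous_in_subspaceT => x /set_mem /=; rewrite in_itv/= => xab.
exact: is_derive1_continuous (dF x xab).
Qed.

Lemma is_derive_MVT F f a b : a < b ->
  (forall x, a <= x <= b -> is_derive x 1 F (f x)) ->
  exists2 c, a < c < b & F b - F a = f c * (b - a).
Proof.
move=> ab dF.
have dF' x : x \in `]a, b[ -> is_derive x 1 F (f x).
  by rewrite in_itv/= => /andP[? ?]; apply: dF; rewrite !ltW.
have [c] := MVT ab dF' (is_derive_within_continuous dF).
by rewrite in_itv; exists c.
Qed.

Lemma le_is_derive_ge0 F f a b : a <= b ->
  (forall x, a <= x <= b -> is_derive x 1 F (f x)) ->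
  (forall x, a < x < b -> 0 <= f x) -> F a <= F b.
Proof.
rewrite le_eqVlt => /predU1P[->//|ab] dF f0.
have [c cab E] := is_derive_MVT ab dF.
by rewrite -subr_ge0 E; apply: mulr_ge0; [exact: f0|lra].
Qed.

Lemma lt_is_derive_gt0 F f a b : a < b ->
  (forall x, a <= x <= b -> is_derive x 1 F (f x)) ->
  (forall x, a < x < b -> 0 < f x) -> F a < F b.
Proof.
move=> ab dF f0.
have [c cab E] := is_derive_MVT ab dF.
by rewrite -subr_gt0 E mulr_gt0 ?subr_gt0// f0.
Qed.

Lemma norm_is_derive_le F f a b (M : R) : a <= b ->
  (forall x, a <= x <= b -> is_derive x 1 F (f x)) ->
  (forall x, a < x < b -> `|f x| <= M) -> `|F b - F a| <= M * (b - a).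
Proof.
rewrite le_eqVlt => /predU1P[->|ab] dF fM; first by rewrite !subrr normr0 mulr0.
have [c cab E] := is_derive_MVT ab dF.
by rewrite E normrM (gtr0_norm (x := b - a)) ?subr_gt0//; apply: ler_wpM2r; [lra|exact: fM].
Qed.

Lemma is_derive_within_cst F a b :
  {within `[a, b], continuous F} ->
  (forall x, a < x < b -> is_derive x 1 F 0) ->
  forall x y, a <= x <= b -> a <= y <= b -> F x = F y.
Proof.
move=> cF dF x y; wlog xy : x y / x <= y => [wlg xab yab|].
  by have [/wlg->//|/ltW/wlg->] := leP x y.
move=> /andP[ax xb] /andP[ay yb]; move: xy; rewrite le_eqVlt => /predU1P[->//|xy].
have [z||c _] := @MVT R F (cst 0) x y xy.
- by rewrite in_itv/= => /andP[? ?]; apply: dF; apply/andP; split; lra.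
- apply: continuous_subspaceW cF; apply: subset_itv; rewrite bnd_simp//.
- by rewrite mul0r => /eqP; rewrite subr_eq0 => /eqP.
Qed.

(** Derivatives are compared twice: [cos <= 1] gives [sin s <= s], which gives the claim. *)
Lemma one_subr_cos_le (psi : R) : 0 <= psi -> 1 - cos psi <= psi ^+ 2 / 2.
Proof.
move=> psi0.
have sle (s : R) : 0 <= s -> sin s <= s.
  move=> s0; have d (x : R) := is_derive1_fctB (is_derive1_fct_id x) (is_derive_sin x).
  have := le_is_derive_ge0 s0 (fun x _ => d x).
  rewrite sin0 subr0 subr_ge0; apply => x _.
  by rewrite subr_ge0 cos_le1.
have d (x : R) := is_derive1_fctD (is_derive1_fctM (is_derive1_fctM (is_derive1_fct_id x)
  (is_derive1_fct_id x)) (is_derive1_fct_cst 2^-1 x)) (is_derive_cos x).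
have := le_is_derive_ge0 psi0 (fun x _ => d x).
rewrite cos0 !mul0r add0r expr2 => H.
suff : 1 <= psi * psi / 2 + cos psi by lra.
apply: H => x /andP[x0 _]; have := sle x (ltW x0); lra.
Qed.

Let primitive_gt (f : R -> R) a : continuous f ->
  exists F, forall x, a < x -> is_derive x 1 F (f x).
Proof.
move=> cf; exists (fun x => \int[lebesgue_measure]_(t in `[a, x]) f t) => x ax.
have xu : x < x + 1 by lra.
have fi : lebesgue_measure.-integrable `[a, x + 1] (EFin \o f).
  apply: continuous_compact_integrable; first exact: segment_compact.
  exact: continuous_subspaceT.
have [dF <-] := continuous_FTC1_closed xu fi ax (cf x).
by rewrite derive1E; exact: derivableP.
Qed.

(** The fundamental theorem of calculus gives a primitive to the right of a base point only. One
    based at [-1] covers [x > -1], the reflection of another covers [x < 1]; on the overlap they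
    differ by a constant, so both are normalised at 0 and glued there. *)
Lemma continuous_primitive f : continuous f ->
  exists2 F, F 0 = 0 & forall x, is_derive x 1 F (f x).
Proof.
move=> cf.
have [F1 dF1] := primitive_gt (-1) cf.
have cfN : continuous (fun x => f (- x)).
  by move=> x; apply: continuous_comp; [exact: continuousN|exact: cf].
have [F2 dF2] := primitive_gt (-1) cfN.
pose G x := - F2 (- x).
have dG x : x < 1 -> is_derive x 1 G (f x).
  move=> x1; have xN : -1 < - x by lra.
  apply: (is_derive_eq (is_derive1_fctN (is_derive1_fct_comp
    (is_derive1_fctN (is_derive1_fct_id x)) (dF2 _ xN)))).
  by rewrite opprK mulrN1 opprK.
have FG x : -1 < x < 1 -> G x - G 0 = F1 x - F1 0.
  move=> x11.
  pose m := Num.min x 0; pose M := Num.max x 0.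
  have hm : -1 < m by rewrite lt_min; apply/andP; split; lra.
  have hM : M < 1 by rewrite gt_max; apply/andP; split; lra.
  have d y : m <= y <= M -> is_derive y 1 (fun t => F1 t - G t) (f y - f y).
    by move=> ?; apply: is_derive1_fctB; [apply: dF1|apply: dG]; lra.
  have := @is_derive_within_cst (fun t => F1 t - G t) m M
    (is_derive_within_continuous d) _ x 0.
  have mM : m <= x <= M by rewrite ge_min le_max lexx.
  have mM0 : m <= 0 <= M by rewrite ge_min le_max lexx !orbT.
  move=> H; suff : F1 x - G x = F1 0 - G 0 by lra.
  by apply: H mM mM0 => y ?; rewrite -(subrr (f y)); apply: d; lra.
exists (fun x => if x < 0 then G x - G 0 else F1 x - F1 0); first by rewrite ltxx subrr.
move=> x; have [x1|x1] := ltP x 1.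
  apply: (@near_eq_is_derive _ _ _ (fun x => G x - G 0)); last first.
    by rewrite -[f x]subr0; exact: (is_derive1_fctB (dG _ x1) (is_derive1_fct_cst _ _)).
  near=> y; case: ifPn => //; rewrite -leNgt => y0; apply: FG.
  apply/andP; split; first by lra.
  by near: y; exact: lt_nbhsl.
apply: (@near_eq_is_derive _ _ _ (fun x => F1 x - F1 0)); last first.
  have x1' : -1 < x by lra.
  by rewrite -[f x]subr0; exact: (is_derive1_fctB (dF1 _ x1') (is_derive1_fct_cst _ _)).
near=> y; case: ifPn => // y0.
suff : 0 < y by lra.
by near: y; apply: lt_nbhsr; lra.
Unshelve. all: by end_near. Qed.

End RealDerivatives.

(** * Solutions of the capillary equations *)

Section Meniscus.
Context {R : realType}.
Implicit Types (k u v s psi phi theta : R).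

(* With [k = sigma / g], the ODE for [y] has the first integral
   [y ^ 2 + 2 * k * cos psi]; [height] is its negative solution through
   [(0, u)], [radius] the radius of curvature [k / |y|], and the solutions of
   the ODE for [x] are [xm - abscissa]. *)
Definition height k u psi := - Num.sqrt (u ^+ 2 + 2 * k * (1 - cos psi)).

Definition radius k u psi := k / - height k u psi.

Definition abscissa k u : R -> R :=
  xget (fun=> 0) [set F : R -> R | F 0 = 0 /\
    forall psi, is_derive psi 1 F (radius k u psi * cos psi)].

(** The coordinate of the curve point of slope [psi] along [(sin phi, cos phi)]. This direction is
    normal to the tangent line of slope [phi], and also to a wall of angle [phi] drawn on the
    left. *)
Definition tilt k u phi psi := sin phi * abscissa k u psi + cos phi * height k u psi.

Section FixedHeight.
Context {k u : R} (k0 : 0 < k) (u0 : u < 0).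

Lemma radicand_gt0 psi : 0 < u ^+ 2 + 2 * k * (1 - cos psi).
Proof.
have := cos_le1 psi; have : 0 < u ^+ 2 by rewrite exprn_even_gt0//= lt_eqF.
by move=> ? ?; rewrite ltr_pwDl// mulr_ge0// ?subr_ge0// mulr_ge0// ltW.
Qed.

Lemma sqr_height psi : height k u psi ^+ 2 = u ^+ 2 + 2 * k * (1 - cos psi).
Proof. by rewrite /height sqrrN sqr_sqrtr// ltW// radicand_gt0. Qed.

Lemma height_lt0 psi : height k u psi < 0.
Proof. by rewrite /height oppr_lt0 sqrtr_gt0 radicand_gt0. Qed.

Lemma height_neq0 psi : height k u psi != 0.
Proof. by rewrite lt_eqF// height_lt0. Qed.

Lemma height0 : height k u 0 = u.
Proof. by rewrite /height cos0 subrr mulr0 addr0 sqrtr_sqr ltr0_norm// opprK. Qed.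

Lemma heightN psi : height k u (- psi) = height k u psi.
Proof. by rewrite /height cosN. Qed.

Lemma radiusN psi : radius k u (- psi) = radius k u psi.
Proof. by rewrite /radius heightN. Qed.

Lemma radius_gt0 psi : 0 < radius k u psi.
Proof. by rewrite divr_gt0// oppr_gt0 height_lt0. Qed.

Lemma radiusM_height psi : radius k u psi * height k u psi = - k.
Proof. by rewrite /radius; field; exact: height_neq0. Qed.

Lemma le_height psi phi : cos psi <= cos phi -> height k u psi <= height k u phi.
Proof.
move=> c; rewrite /height lerN2 ler_wsqrtr// lerD2l ler_wpM2l ?lerD2l ?lerN2//.
by rewrite mulr_ge0// ltW.
Qed.

Lemma lt_height psi phi : cos psi < cos phi -> height k u psi < height k u phi.
Proof.
move=> c; rewrite /height ltrN2 ltr_sqrt ?radicand_gt0//.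
by rewrite ltrD2l ltr_pM2l ?ltrD2l ?ltrN2// mulr_gt0.
Qed.

Lemma height_le psi : height k u psi <= u.
Proof. by rewrite -[leRHS]height0; apply: le_height; rewrite cos0 cos_le1. Qed.

Lemma le_radius psi phi : cos psi <= cos phi -> radius k u psi <= radius k u phi.
Proof.
move=> /le_height H; rewrite /radius ler_pM2l// lef_pV2 ?posrE ?oppr_gt0 ?height_lt0//.
by rewrite lerN2.
Qed.

Lemma is_derive_height psi : is_derive psi 1 (height k u) (- (radius k u psi * sin psi)).
Proof.
have H : is_derive psi 1 (fun t => u ^+ 2 + 2 * k * (1 - cos t)) (2 * k * sin psi).
  apply: is_derive_eq (is_derive1_fctD (is_derive1_fct_cst _ _) (is_derive1_fctM
    (is_derive1_fct_cst _ _) (is_derive1_fctB (is_derive1_fct_cst _ _) (is_derive_cos psi)))) _.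
  by ring.
have D := is_derive1_fctN (is_derive1_fct_comp H (is_derive1_sqrt (radicand_gt0 psi))).
apply: (is_derive_eq D).
have := radicand_gt0 psi; rewrite -sqrtr_gt0 => s0.
rewrite /radius /height opprK; field.
by rewrite gt_eqF.
Qed.

Lemma continuous_radius : continuous (radius k u).
Proof.
move=> psi; apply: cvgM; first exact: cvg_cst.
apply: cvgV; first by rewrite oppr_eq0 height_neq0.
by apply: cvgN; exact: is_derive1_continuous (is_derive_height psi).
Qed.

Let abscissa_spec : abscissa k u 0 = 0 /\
  forall psi, is_derive psi 1 (abscissa k u) (radius k u psi * cos psi).
Proof.
have [|F F0 dF] := @continuous_primitive R (fun psi => radius k u psi * cos psi).
  by move=> psi; apply: cvgM; [exact: continuous_radius|exact: continuous_cos].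
by apply: (@xgetPex _ (fun=> 0) [set F : R -> R | F 0 = 0 /\
    forall psi, is_derive psi 1 F (radius k u psi * cos psi)]); exists F.
Qed.

Lemma abscissa0 : abscissa k u 0 = 0.
Proof. exact: abscissa_spec.1. Qed.

Lemma is_derive_abscissa psi :
  is_derive psi 1 (abscissa k u) (radius k u psi * cos psi).
Proof. exact: abscissa_spec.2. Qed.

Lemma abscissaN psi : abscissa k u (- psi) = - abscissa k u psi.
Proof.
suff : abscissa k u psi + abscissa k u (- psi) = abscissa k u 0 + abscissa k u (- 0).
  by rewrite oppr0 abscissa0 => ?; lra.
apply: (@is_derive_0_is_cst _ (fun s => abscissa k u s + abscissa k u (- s))) => s.
apply: is_derive_eq (is_derive1_fctD (is_derive_abscissa s) (is_derive1_fct_comp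
  (is_derive1_fctN (is_derive1_fct_id s)) (is_derive_abscissa (- s)))) _.
by rewrite radiusN cosN; ring.
Qed.

Lemma is_derive_tilt phi psi :
  is_derive psi 1 (tilt k u phi) (radius k u psi * sin (phi - psi)).
Proof.
apply: is_derive_eq (is_derive1_fctD
  (is_derive1_fctM (is_derive1_fct_cst (sin phi) psi) (is_derive_abscissa psi))
  (is_derive1_fctM (is_derive1_fct_cst (cos phi) psi) (is_derive_height psi))) _.
by rewrite sinB; ring.
Qed.

Lemma tilt_lt theta a b : theta - pi <= a -> a < b -> b <= theta ->
  tilt k u theta a < tilt k u theta b.
Proof.
move=> ta ab bt; apply: (lt_is_derive_gt0 ab (fun x _ => is_derive_tilt theta x)) => x ?.
by rewrite mulr_gt0 ?radius_gt0// sin_gt0_pi//; lra.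
Qed.

Lemma tilt_gt theta a b : theta <= a -> a < b -> b <= theta + pi ->
  tilt k u theta b < tilt k u theta a.
Proof.
move=> ta ab bt; rewrite -ltrN2.
apply: (lt_is_derive_gt0 ab (fun x _ => is_derive1_fctN (is_derive_tilt theta x))) => x ?.
by rewrite -mulrN -sinN mulr_gt0 ?radius_gt0// sin_gt0_pi//; lra.
Qed.

(* The radius of curvature is larger on the side of the bottom of the
   meniscus, so reflecting in [theta] towards it lowers the tilt function. *)
Lemma tilt_reflect theta phi : 0 <= theta <= pi -> 0 <= phi <= pi ->
  tilt k u theta (theta - phi) <= tilt k u theta (theta + phi).
Proof.
move=> theta0 /andP[phi0 phipi]; rewrite -subr_ge0.
have dp s := is_derive1_fctD (is_derive1_fct_cst theta s) (is_derive1_fct_id s).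
have dm s := is_derive1_fctB (is_derive1_fct_cst theta s) (is_derive1_fct_id s).
have d s := is_derive1_fctB
  (is_derive1_fct_comp (dp s) (is_derive_tilt theta (theta + s)))
  (is_derive1_fct_comp (dm s) (is_derive_tilt theta (theta - s))).
have := @le_is_derive_ge0 _ _ _ _ _ phi0 (fun s _ => d s).
rewrite addr0 subr0 subrr; apply => s s0.
rewrite (_ : theta - (theta + s) = - s); last by ring.
rewrite (_ : theta - (theta - s) = s); last by ring.
rewrite sinN (_ : _ - _ = sin s * (radius k u (theta - s) - radius k u (theta + s))); last by ring.
rewrite mulr_ge0 ?subr_ge0//; first by rewrite sin_ge0_pi//; lra.
apply: le_radius; rewrite cosD cosB.
have : 0 <= sin theta * sin s by rewrite mulr_ge0// sin_ge0_pi//; lra.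
by lra.
Qed.

(** If [b] has passed the maximum at [theta], its mirror image [2 * theta - b] still lies to the
    right of [a]: the tilt rises from [a] to the image and does not drop under the reflection. *)
Lemma tilt_lt_reflect theta a b : 0 <= theta <= pi -> theta - pi <= a ->
  a < b -> b <= theta + pi -> a + b < 2 * theta ->
  tilt k u theta a < tilt k u theta b.
Proof.
move=> theta0 pa ab bp abt.
have [bt|tb] := leP b theta; first exact: tilt_lt.
have r : 0 <= b - theta <= pi by lra.
have := tilt_reflect theta0 r.
rewrite (_ : theta + (b - theta) = b); last by ring.
apply: lt_le_trans; apply: tilt_lt; lra.
Qed.

(** For [theta = pi / 2] the tilt is the abscissa itself. Past [pi / 2] the abscissa decreases,
    hence the appeal to the reflection. *)
Lemma abscissa_gt0 psi : 0 < psi < pi -> 0 < abscissa k u psi.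
Proof.
move=> psi0.
have := @tilt_lt_reflect (pi / 2) 0 psi.
rewrite /tilt sin_pihalf cos_pihalf !mul1r !mul0r !addr0 abscissa0.
by apply; have := pi_gt0 R; lra.
Qed.

End FixedHeight.

Lemma height_lt_left k u v psi : 0 < k -> u < v -> v < 0 -> height k u psi < height k v psi.
Proof.
move=> k0 uv v0; have u0 : u < 0 by exact: lt_trans v0.
rewrite /height ltrN2 ltr_sqrt ?radicand_gt0// ltrD2r.
by rewrite -[ltRHS]sqrrN -[ltLHS]sqrrN ltr_pXn2r ?nnegrE//; lra.
Qed.

Lemma radius_lt_left k u v psi : 0 < k -> u < v -> v < 0 -> radius k u psi < radius k v psi.
Proof.
move=> k0 uv v0; have u0 : u < 0 by exact: lt_trans v0.
rewrite /radius ltr_pM2l// ltf_pV2 ?posrE ?oppr_gt0 ?height_lt0//.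
by rewrite ltrN2 height_lt_left.
Qed.

End Meniscus.

(** * One wall and its contact point *)

Section Continuity.
Context {R : realType}.

(** Meant for [acos], known to be continuous within [[-1, 1]]: an inner function that never leaves
    this interval gives continuity on the whole line. *)
Lemma continuous_comp_within (S T U : topologicalType) (A : set T) (f : T -> U) (g : S -> T) :
  {within A, continuous f} -> continuous g -> (forall x, A (g x)) ->
  continuous (fun x => f (g x)).
Proof.
move=> /continuousP cf cg Ag; apply/continuousP => B oB.
have /open_subspaceP[V oV VA] := cf B oB.
rewrite (_ : _ @^-1` B = g @^-1` V); first by move/continuousP: cg; exact.
apply/seteqP; split => x /= Bx.
  by have : (f @^-1` B `&` A) (g x) by []; rewrite -VA => -[].
by have : (V `&` A) (g x) by []; rewrite VA => -[].
Qed.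

Lemma integral_FTC (f F : R -> R) (a b : R) : a < b -> continuous f ->
  continuous F -> (forall x, a < x < b -> is_derive x 1 F (f x)) ->
  \int[lebesgue_measure]_(x in `[a, b]) f x = F b - F a.
Proof.
move=> ab cf cF dF; rewrite /Rintegral (@continuous_FTC2 _ f F)//.
- exact: continuous_subspaceT.
- have [_ H1 H2] := (continuous_within_itvP F ab).1 (continuous_subspaceT cF).
  by split => // x; rewrite in_itv/= => /dF [].
- by move=> x; rewrite in_itv/= => /dF H; rewrite derive1E; exact: derive_val.
Qed.

Lemma integral_piecewise_FTC (f F1 F2 : R -> R) (a m b : R) : a < m -> m < b -> continuous f ->
  continuous F1 -> (forall x, a < x < m -> is_derive x 1 F1 (f x)) ->
  continuous F2 -> (forall x, m < x < b -> is_derive x 1 F2 (f x)) ->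
  \int[lebesgue_measure]_(x in `[a, b]) f x = (F1 m - F1 a) + (F2 b - F2 m).
Proof.
move=> am mb cf cF1 dF1 cF2 dF2.
have fi x y : lebesgue_measure.-integrable `[x, y] (EFin \o f).
  apply: continuous_compact_integrable; first exact: segment_compact.
  exact: continuous_subspaceT.
rewrite -(integral_FTC am cf cF1 dF1) -(integral_FTC mb cf cF2 dF2).
apply/eqP; rewrite addrC -subr_eq Rintegral_itvB ?bnd_simp ?ltW//.
rewrite Rintegral_itv_obnd_cbnd//.
by apply: integrableS (fi m b) => //; exact: subset_itv_oc_cc.
Qed.

End Continuity.

Section Contact.
Context {R : realType}.
Implicit Types (k u beta theta psi h : R).

(* With [beta = gamma + pi / 2] the slope angle at the wall of angle [theta]
   has modulus [beta - theta]. Each half of the drop is drawn with its wall on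
   the right (the left one after a reflection): [wall_length] is the distance
   from the vertex to the contact point, [apex] the height of the vertex,
   [offset] the abscissa of the bottom point of slope [0] and [support] the
   distance from the vertex to the tangent line of slope [psi]. *)
Definition wall_length k u beta theta theta' :=
  (tilt k u theta' (beta - theta) - tilt k u theta' (- (beta - theta')))
  / sin (theta + theta').

Definition apex k u beta theta theta' :=
  height k u (beta - theta) - wall_length k u beta theta theta' * sin theta.

Definition offset k u beta theta theta' :=
  wall_length k u beta theta theta' * cos theta - abscissa k u (beta - theta).

(* The algebraic area between the [y]-axis and this half of the boundary, up
   to the term [offset * u], which cancels between the two halves. *)
Definition half_area k u beta theta theta' :=
  wall_length k u beta theta theta' ^+ 2 * sin theta * cos theta / 2
  - wall_length k u beta theta theta' * cos theta * height k u (beta - theta)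
  - k * sin (beta - theta).

Definition support k u beta theta theta' psi :=
  (offset k u beta theta theta' + abscissa k u psi) * sin psi +
  (height k u psi - apex k u beta theta theta') * cos psi.

(* The inverse of [height] on [[0, a]]; clamping [h] makes it continuous on the
   whole line. *)
Definition slope k u a h :=
  acos (1 - (Num.max (height k u a) (Num.min u h) ^+ 2 - u ^+ 2) / (2 * k)).

(** Below the contact height the clamp freezes the first two terms at the contact point and the
    [Num.min] term continues along the wall; above it that term vanishes and the curve remains. A
    single formula keeps the function continuous on the whole line. *)
Definition profile k u beta theta theta' h :=
  offset k u beta theta theta' + abscissa k u (slope k u (beta - theta) h)
  + cos theta / sin theta * Num.min (h - height k u (beta - theta)) 0.

Context {k u beta theta theta' : R} (k0 : 0 < k) (u0 : u < 0) (beta_pi : beta <= pi).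
Context (th0 : 0 < theta < beta) (th0' : 0 < theta' < beta) (thth : theta + theta' < pi).

Local Notation a := (beta - theta).
Local Notation t := (wall_length k u beta theta theta').
Local Notation t' := (wall_length k u beta theta' theta).

Local Ltac slra := move: (th0) (th0') (thth) (beta_pi) (u0) => ? ? ? ? ?; lra.

Let a0 : 0 < a. Proof. by slra. Qed.
Let api : a < pi. Proof. by slra. Qed.

Let sth : 0 < sin theta. Proof. by rewrite sin_gt0_pi//; slra. Qed.
Let sthth : 0 < sin (theta + theta'). Proof. by rewrite sin_gt0_pi//; slra. Qed.

(** The slopes compared, [- (beta - theta')] and [beta - theta], add up to
    [theta' - theta < 2 * theta'], and the lower bound [theta' - pi] demanded by the reflection
    argument is [beta <= pi]. *)
Lemma wall_length_gt0 : 0 < t.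
Proof.
rewrite /wall_length divr_gt0// subr_gt0.
by apply: tilt_lt_reflect => //; slra.
Qed.

Let tE : t = (sin theta' * (abscissa k u a + abscissa k u (beta - theta')) +
  cos theta' * (height k u a - height k u (beta - theta'))) / sin (theta + theta').
Proof. by rewrite /wall_length /tilt abscissaN// heightN//; congr (_ / _); ring. Qed.

Let t'E : t' = (sin theta * (abscissa k u a + abscissa k u (beta - theta')) -
  cos theta * (height k u a - height k u (beta - theta'))) / sin (theta + theta').
Proof.
rewrite /wall_length /tilt abscissaN// heightN// [theta' + theta]addrC.
by congr (_ / _); ring.
Qed.

(** The two components of the chord joining the contact points, computed through the vertex and
    along the curve. [wall_length] is Cramer's rule for this system, whose determinant is
    [sin (theta + theta')] up to sign: projecting the chord on the normal of one wall eliminates the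
    length along it. *)
Lemma wall_lengthP : t * cos theta + t' * cos theta' =
    abscissa k u a + abscissa k u (beta - theta') /\
  t * sin theta - t' * sin theta' = height k u a - height k u (beta - theta').
Proof.
rewrite tE t'E; set X := _ + abscissa _ _ _; set Y := _ - height _ _ _.
have s0 : sin (theta + theta') != 0 by rewrite gt_eqF.
by move: s0; rewrite sinD => s0; split; field; exact: s0.
Qed.

Lemma wall_length_unique (s s' : R) :
  s * cos theta + s' * cos theta' = abscissa k u a + abscissa k u (beta - theta') ->
  s * sin theta - s' * sin theta' = height k u a - height k u (beta - theta') ->
  s = t /\ s' = t'.
Proof.
rewrite tE t'E.
move=> <- <-.
have s0 : sin (theta + theta') != 0 by rewrite gt_eqF.
by move: s0; rewrite sinD => s0; split; field; exact: s0.
Qed.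

Lemma apexC : apex k u beta theta' theta = apex k u beta theta theta'.
Proof. by rewrite /apex; have := wall_lengthP.2; slra. Qed.

Lemma offsetC : offset k u beta theta' theta = - offset k u beta theta theta'.
Proof. by rewrite /offset; have := wall_lengthP.1; slra. Qed.

Lemma supportE psi : support k u beta theta theta' psi =
  tilt k u psi psi + offset k u beta theta theta' * sin psi
  - apex k u beta theta theta' * cos psi.
Proof. by rewrite /support /tilt; ring. Qed.

(* The support function dominates the distance from the tangent line to the
   contact point, the latter being at distance [t * sin (theta + psi)]. *)
Lemma support_gt psi : 0 <= psi < a -> t * sin (theta + psi) < support k u beta theta theta' psi.
Proof.
move=> psi0; rewrite supportE.
have : tilt k u psi a < tilt k u psi psi by apply: tilt_gt => //; slra.
suff : tilt k u psi a + offset k u beta theta theta' * sin psi -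
  apex k u beta theta theta' * cos psi = t * sin (theta + psi) by slra.
by rewrite /tilt /offset /apex sinD; ring.
Qed.

Lemma support_gt0 psi : 0 <= psi < a -> 0 < support k u beta theta theta' psi.
Proof.
move=> psi0; apply: le_lt_trans (support_gt psi0).
rewrite mulr_ge0//; first exact/ltW/wall_length_gt0.
by rewrite sin_ge0_pi//; move: psi0; slra.
Qed.

(** At slope 0 the support function is [u - apex]. *)
Lemma apex_lt : apex k u beta theta theta' < u.
Proof.
have := @support_gt0 0; rewrite lexx a0 => /(_ isT).
by rewrite /support sin0 cos0 height0//; slra.
Qed.

Lemma apex_lt_height : apex k u beta theta theta' < height k u a.
Proof. by rewrite /apex ltrBlDr ltrDl mulr_gt0// wall_length_gt0. Qed.

Let cos_mono (x y : R) : 0 <= x <= pi -> 0 <= y <= pi -> (cos x < cos y) = (y < x).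
Proof. by move=> ? ?; rewrite ltr_cos// in_itv. Qed.

Lemma slope_height psi : 0 <= psi <= a -> slope k u a (height k u psi) = psi.
Proof.
move=> psi0; rewrite /slope (min_idPr _) ?height_le// (max_idPr _); last first.
  apply: le_height => //; rewrite leNgt cos_mono; slra.
rewrite sqr_height// (_ : 1 - _ = cos psi) ?cosK ?in_itv/=; [by []|slra|].
by field; rewrite gt_eqF.
Qed.

Lemma height_onto h : height k u a <= h <= u -> exists2 psi, 0 <= psi <= a & height k u psi = h.
Proof.
move=> hu; have [||psi] := @IVT _ (height k u) 0 a h (ltW a0).
- exact: (is_derive_within_continuous (fun s _ => is_derive_height k0 u0 s)).
- by rewrite height0// min_r ?max_l//; slra.
- by rewrite in_itv/=; exists psi.
Qed.

Lemma slope_in h : 0 <= slope k u a h <= a /\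
  height k u (slope k u a h) = Num.max (height k u a) (Num.min u h).
Proof.
set m := Num.max _ _.
have am : height k u a <= m by rewrite le_max lexx.
have mu : m <= u by rewrite ge_max height_le//= ge_min lexx.
have [|psi psi0 E] := @height_onto m; first by rewrite am mu.
suff -> : slope k u a h = psi by [].
rewrite -[RHS](slope_height psi0) E /slope; congr (acos (1 - (_ ^+ 2 - _) / _)).
by rewrite (min_idPr mu) (max_idPr am).
Qed.

Lemma slope_le_height h : h <= height k u a -> slope k u a h = a.
Proof.
move=> ha; rewrite -[RHS]slope_height; last by slra.
rewrite /slope; congr (acos (1 - (_ ^+ 2 - _) / _)).
have hu := height_le k0 u0 a.
by rewrite !(min_idPr _) ?(le_trans ha)// maxxx; apply/max_idPl.
Qed.

Lemma continuous_slope : continuous (slope k u a).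
Proof.
have cacos : {within `[-1, 1], continuous (@acos R)}.
  have := @segment_can_ge_continuous R 0 pi cos acos (ltW (pi_gt0 R)).
  rewrite cos0 cospi; apply; last exact: cosK.
  exact/continuous_subspaceT/continuous_cos.
pose g h := 1 - (Num.max (height k u a) (Num.min u h) ^+ 2 - u ^+ 2) / (2 * k).
have gA h : `[-1, 1]%classic (g h).
  have [_ E] := slope_in h.
  rewrite /g -E sqr_height// (_ : 1 - _ = cos (slope k u a h)); last first.
    by field; rewrite gt_eqF.
  by rewrite /= in_itv/= cos_geN1 cos_le1.
have cg : continuous g.
  move=> h; apply: cvgB; first exact: cvg_cst.
  apply: cvgM; last exact: cvg_cst.
  apply: cvgB; last exact: cvg_cst.
  have c1 : (fun h => Num.max (height k u a) (Num.min u h)) @ h -->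
      Num.max (height k u a) (Num.min u h).
    apply: (@continuous_max _ _ (fun=> height k u a) (fun h => Num.min u h)).
      exact: cvg_cst.
    by apply: (@continuous_min _ _ (fun=> u) id); [exact: cvg_cst|exact: cvg_id].
  by rewrite [X in _ --> X]expr2; under eq_fun do rewrite expr2; exact: cvgM.
exact: (continuous_comp_within cacos cg gA).
Qed.

Lemma profile_wall h : h <= height k u a ->
  profile k u beta theta theta' h =
  (h - apex k u beta theta theta') * (cos theta / sin theta).
Proof.
move=> ha; rewrite /profile slope_le_height// min_l ?subr_le0//.
rewrite /offset /apex; field; exact/lt0r_neq0.
Qed.

Lemma profile_curve psi : 0 <= psi <= a ->
  profile k u beta theta theta' (height k u psi) =
  offset k u beta theta theta' + abscissa k u psi.
Proof.
move=> psi0; rewrite /profile slope_height// min_r ?mulr0 ?addr0// subr_ge0.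
by apply: le_height => //; rewrite leNgt cos_mono; slra.
Qed.

Lemma profile_apex : profile k u beta theta theta' (apex k u beta theta theta') = 0.
Proof. by rewrite profile_wall ?subrr ?mul0r// ltW// apex_lt_height. Qed.

Lemma profile_bottom : profile k u beta theta theta' u = offset k u beta theta theta'.
Proof.
rewrite -[X in profile _ _ _ _ _ X](height0 u0 (k := k)) profile_curve; last by slra.
by rewrite abscissa0// addr0.
Qed.

Lemma continuous_profile : continuous (profile k u beta theta theta').
Proof.
move=> h; apply: cvgD.
  apply: cvgD; first exact: cvg_cst.
  apply: continuous_comp; first exact: continuous_slope.
  exact: is_derive1_continuous (is_derive_abscissa k0 u0 _).
apply: cvgM; first exact: cvg_cst.
apply: (@continuous_min _ _ (fun h => h - height k u a) (fun=> 0)); last exact: cvg_cst.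
by apply: cvgB; [exact: cvg_id|exact: cvg_cst].
Qed.

Lemma is_derive_slope psi : 0 < psi < a ->
  is_derive (height k u psi) 1 (slope k u a) (height k u psi / (k * sin psi)).
Proof.
move=> psi0; have sp : 0 < sin psi by rewrite sin_gt0_pi//; slra.
have E : 1 - (height k u psi * height k u psi - u ^+ 2) / (2 * k) = cos psi.
  by rewrite -expr2 sqr_height//; field; rewrite gt_eqF.
pose g h := 1 - (h * h - u ^+ 2) / (2 * k).
(* Strictly between the two extreme heights the clamp is inactive. *)
apply: (@near_eq_is_derive _ _ _ (fun h => acos (g h))); last first.
  have d := is_derive1_fctB (is_derive1_fct_cst 1 (height k u psi)) (is_derive1_fctM (is_derive1_fctB
   (is_derive1_fctM (is_derive1_fct_id (height k u psi)) (is_derive1_fct_id (height k u psi)))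
   (is_derive1_fct_cst (u ^+ 2) _)) (is_derive1_fct_cst (2 * k)^-1 _)).
  have c1 : -1 < g (height k u psi) < 1.
    rewrite /g E -[X in X < _ < _]cospi -[X in _ < _ < X]cos0 !cos_mono; slra.
  apply: (is_derive_eq (is_derive1_fct_comp d (is_derive1_acos c1))).
  rewrite /g E -sin2cos2 sqrtr_sqr gtr0_norm//; field.
  by rewrite !gt_eqF.
have hu : height k u psi < u.
  by rewrite -[ltRHS](height0 u0 (k := k)); apply: lt_height => //; rewrite cos_mono; slra.
have ah : height k u a < height k u psi by apply: lt_height => //; rewrite cos_mono; slra.
near=> h; have h1 : h < u by near: h; exact: lt_nbhsl.
have h2 : height k u a < h by near: h; exact: lt_nbhsr.
by rewrite /slope /g -expr2 (min_idPr (ltW h1)) (max_idPr (ltW h2)).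
Unshelve. all: by end_near. Qed.

(** Integration by parts: the remaining integrand is height times the differential of the abscissa,
    that is [- k * cos psi] in the variable [psi], because [radius * height = - k]. *)
Lemma is_derive_curve_primitive psi : 0 < psi < a ->
  is_derive (height k u psi) 1 (fun h => h * (offset k u beta theta theta' + abscissa k u (slope k u a h))
  + k * sin (slope k u a h)) (profile k u beta theta theta' (height k u psi)).
Proof.
move=> psi0; have psi1 : 0 <= psi <= a by slra.
rewrite (profile_curve psi1).
have ds := is_derive_slope psi0.
have E := slope_height psi1.
have dA0 := is_derive_abscissa k0 u0 (slope k u a (height k u psi)).
have dS0 := is_derive_sin (slope k u a (height k u psi)).
have dA := is_derive1_fct_comp ds dA0.
have dS := is_derive1_fct_comp ds dS0.
have d1 := is_derive1_fctM (is_derive1_fct_id (height k u psi))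
    (is_derive1_fctD (is_derive1_fct_cst (offset k u beta theta theta') _) dA).
have d := is_derive1_fctD d1 (is_derive1_fctM (is_derive1_fct_cst k _) dS).
apply: (is_derive_eq d); rewrite E.
have sp : sin psi != 0 by rewrite gt_eqF// sin_gt0_pi//; slra.
have hp := height_neq0 k0 u0 psi.
have k1 : k != 0 by rewrite gt_eqF.
rewrite /radius; set eta := height k u psi in hp *; field.
by rewrite sp hp k1.
Qed.

Lemma integral_profile :
  \int[lebesgue_measure]_(h in `[apex k u beta theta theta', u]) profile k u beta theta theta' h
  = half_area k u beta theta theta' + offset k u beta theta theta' * u.
Proof.
pose F1 h := (h - apex k u beta theta theta') ^+ 2 / 2 * (cos theta / sin theta).
pose F2 h := h * (offset k u beta theta theta' + abscissa k u (slope k u a h))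
  + k * sin (slope k u a h).
have ha : height k u a < u.
  rewrite -[ltRHS](height0 u0 (k := k)); apply: lt_height => //.
  by rewrite cos_mono; slra.
have s1 : 0 <= a <= a by slra.
have E2 : slope k u a u = 0.
  by rewrite -[X in slope _ _ _ X](height0 u0 (k := k)) slope_height//; slra.
have cF1 : continuous F1.
  move=> h; apply: cvgM; last exact: cvg_cst.
  apply: cvgM; last exact: cvg_cst.
  have c : (fun h => h - apex k u beta theta theta') x @[x --> h] --> h - apex k u beta theta theta'.
    by apply: cvgB; [exact: cvg_id|exact: cvg_cst].
  by rewrite [X in _ --> X]expr2; under eq_fun do rewrite expr2; exact: cvgM.
have dF1 h : apex k u beta theta theta' < h < height k u a ->
    is_derive h 1 F1 (profile k u beta theta theta' h).
  move=> h0; rewrite profile_wall; last by slra.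
  have d := is_derive1_fctB (is_derive1_fct_id h) (is_derive1_fct_cst (apex k u beta theta theta') h).
  have d2 := is_derive1_fctM (is_derive1_fctM (is_derive1_fctM d d) (is_derive1_fct_cst 2^-1 h))
    (is_derive1_fct_cst (cos theta / sin theta) h).
  by apply: (is_derive_eq d2); field; exact/lt0r_neq0.
have cF2 : continuous F2.
  move=> h; apply: cvgD; apply: cvgM; [exact: cvg_id| |exact: cvg_cst|].
    apply: cvgD; first exact: cvg_cst.
    apply: continuous_comp; first exact: continuous_slope.
    exact: is_derive1_continuous (is_derive_abscissa k0 u0 _).
  by apply: continuous_comp; [exact: continuous_slope|exact: continuous_sin].
have dF2 h : height k u a < h < u -> is_derive h 1 F2 (profile k u beta theta theta' h).
  move=> /andP[ah hu].
  have [|psi /andP[p0 pa] E] := @height_onto h; first by rewrite !ltW.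
  have psi0 : 0 < psi < a.
    rewrite lt_neqAle p0 lt_neqAle pa !andbT; apply/andP; split; apply/negP => /eqP E'.
      by move: hu; rewrite -E -E' height0// ltxx.
    by move: ah; rewrite -E E' ltxx.
  by rewrite -E; exact: is_derive_curve_primitive.
rewrite (integral_piecewise_FTC apex_lt_height ha continuous_profile cF1 dF1 cF2 dF2).
rewrite /F1 /F2 (slope_height s1) E2 subrr abscissa0// sin0 /half_area.
by rewrite /apex /offset; field; exact/lt0r_neq0.
Qed.

End Contact.

(** * The region enclosed by the drop *)

Section DropRegion.
Context {R : realType}.
Implicit Types (k u beta theta psi h X : R).

(** As [theta' <= theta], the contact point on the side of [theta] is not the lower one. A level
    therefore meets the curve twice, the wall of [theta] and the curve, or both walls. *)
Let profileD_gt0_le k u beta theta theta' h : 0 < k -> u < 0 -> beta <= pi ->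
  0 < theta < beta -> 0 < theta' < beta -> theta + theta' < pi -> theta' <= theta ->
  apex k u beta theta theta' < h < u ->
  0 < profile k u beta theta theta' h + profile k u beta theta' theta h.
Proof.
move=> k0 u0 bpi th0 th0' thth thle /andP[ah hu].
have thth' : theta' + theta < pi by rewrite addrC.
have sth : 0 < sin theta by rewrite sin_gt0_pi//; lra.
have sth' : 0 < sin theta' by rewrite sin_gt0_pi//; lra.
have sthth : 0 < sin (theta + theta') by rewrite sin_gt0_pi//; lra.
have aC := apexC k0 u0 bpi th0 th0' thth.
have oC := offsetC k0 u0 bpi th0 th0' thth.
(* Above both contact points the two sides have the same slope [psi], and the width is twice the
   abscissa. *)
have [hle|hlt] := leP (height k u (beta - theta)) h.
  have hh : height k u (beta - theta) <= h <= u by rewrite hle ltW.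
  have [psi psi0 E] := height_onto k0 u0 bpi th0 th0' thth hh.
  have psi0' : 0 <= psi <= beta - theta' by lra.
  have psi_gt0 : 0 < psi.
    rewrite lt_neqAle (andP psi0).1 andbT; apply/negP => /eqP E'.
    by move: hu; rewrite -E -E' height0// ltxx.
  rewrite -E (profile_curve k0 u0 bpi th0 th0' thth)// (profile_curve k0 u0 bpi th0' th0 thth')// oC.
  by have := abscissa_gt0 k0 u0 (psi := psi); lra.
rewrite (profile_wall k0 u0 bpi th0 th0' thth) ?(ltW hlt)//.
(* Below both contact points the width is [h - apex] times the sum of the two cotangents. *)
have [hle'|hlt'] := leP (height k u (beta - theta')) h; last first.
  rewrite (profile_wall k0 u0 bpi th0' th0 thth') ?(ltW hlt')// aC -mulrDr.
  rewrite mulr_gt0 ?subr_gt0// (_ : _ + _ = sin (theta + theta') / (sin theta * sin theta')).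
    by rewrite divr_gt0// mulr_gt0.
  by rewrite sinD; field; rewrite !gt_eqF.
have hh : height k u (beta - theta') <= h <= u by rewrite hle' ltW.
have [psi psi0 E] := height_onto k0 u0 bpi th0' th0 thth' hh.
have apsi : beta - theta < psi.
  rewrite ltNge; apply/negP => psile; move: hlt; rewrite -E ltNge => /negP; apply.
  by apply: le_height => //; rewrite leNgt ltr_cos ?in_itv/=; lra.
rewrite -E (profile_curve k0 u0 bpi th0' th0 thth')// oC.
set A := apex _ _ _ _ _; set O := offset _ _ _ _ _.
(* Multiplied by [sin theta], the width is the distance from the curve point to the wall of [theta]
   on the opposite side. *)
suff : 0 < tilt k u theta psi - A * cos theta - O * sin theta.
  rewrite /tilt => H; rewrite -(pmulr_rgt0 _ sth).
  rewrite (_ : sin theta * _ = sin theta * abscissa k u psi + cos theta * height k u psi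
     - A * cos theta - O * sin theta)//.
  by field; rewrite gt_eqF.
(* On the rising part of the tilt the comparison is with slope [beta - theta], the mirror image of
   this wall's own contact point; on the falling part, with the contact point of the other wall. *)
have [psile|psigt] := leP psi theta.
  have : tilt k u theta (beta - theta) < tilt k u theta psi by apply: tilt_lt => //; lra.
  have -> : tilt k u theta (beta - theta) =
      A * cos theta + O * sin theta + 2 * (sin theta * abscissa k u (beta - theta)).
    by rewrite /tilt /A /O /apex /offset; ring.
  have : 0 < sin theta * abscissa k u (beta - theta).
    by rewrite mulr_gt0//; apply: abscissa_gt0 => //; lra.
  by lra.
have : tilt k u theta (beta - theta') <= tilt k u theta psi.
  move: psi0 => /andP[_]; rewrite le_eqVlt => /predU1P[->//|psilt].
  by apply/ltW/tilt_gt => //; lra.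
have -> : tilt k u theta (beta - theta') = A * cos theta + O * sin theta +
    wall_length k u beta theta' theta * sin (theta + theta').
  have -> : O = - offset k u beta theta' theta by rewrite oC opprK.
  by rewrite /A -aC /tilt /apex /offset sinD; ring.
have := mulr_gt0 (wall_length_gt0 k0 u0 bpi th0' th0 thth') sthth.
by lra.
Qed.

Lemma profileD_gt0 k u beta theta theta' h : 0 < k -> u < 0 -> beta <= pi ->
  0 < theta < beta -> 0 < theta' < beta -> theta + theta' < pi ->
  apex k u beta theta theta' < h < u ->
  0 < profile k u beta theta theta' h + profile k u beta theta' theta h.
Proof.
move=> k0 u0 bpi th0 th0' thth hh.
have [le|/ltW le] := leP theta' theta; first exact: profileD_gt0_le.
rewrite addrC; apply: profileD_gt0_le => //; first by rewrite addrC.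
by rewrite apexC.
Qed.

(** The boundary of the drop is given by parametrisations, while the area argument works with graphs
    over the height; this is the dictionary for one half. *)
Lemma profile_graphP k u beta theta theta' X h : 0 < k -> u < 0 -> beta <= pi ->
  0 < theta < beta -> 0 < theta' < beta -> theta + theta' < pi ->
  let a := beta - theta in let t := wall_length k u beta theta theta' in
  apex k u beta theta theta' <= h <= u /\ X = profile k u beta theta theta' h <->
  (exists2 psi, 0 <= psi <= a &
    X = offset k u beta theta theta' + abscissa k u psi /\ h = height k u psi) \/
  (exists2 s, 0 <= s <= 1 &
    X = s * (t * cos theta) /\ h = apex k u beta theta theta' + s * (t * sin theta)).
Proof.
move=> k0 u0 bpi th0 th0' thth a t.
have sth : 0 < sin theta by rewrite sin_gt0_pi//; lra.
have t0 : 0 < t by apply: wall_length_gt0.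
have ts := mulr_gt0 t0 sth.
have Ea : height k u a = apex k u beta theta theta' + t * sin theta by rewrite /apex /t /a; ring.
have au := height_le k0 u0 a.
split=> [[/andP[Ah hu] ->]|[[psi psi0 [-> ->]]|[s s0 [-> ->]]]].
- have [hle|hlt] := leP (height k u a) h.
    have hh : height k u (beta - theta) <= h <= u by rewrite hle.
    have [psi psi0 E] := height_onto k0 u0 bpi th0 th0' thth hh.
    by left; exists psi => //; rewrite -E profile_curve.
  right; exists ((h - apex k u beta theta theta') / (t * sin theta)).
    rewrite divr_ge0 ?subr_ge0 ?(ltW ts)//= ler_pdivrMr// mul1r.
    by move: hlt; rewrite Ea; lra.
  rewrite profile_wall ?(ltW hlt)//; split; field; rewrite ?gt_eqF//.
- rewrite height_le// profile_curve// andbT; split=> //.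
  rewrite (@le_trans _ _ (height k u a))//; first exact/ltW/apex_lt_height.
  rewrite /a in psi0 *; apply: le_height => //; rewrite leNgt ltr_cos ?in_itv/=; lra.
- have H : s * (t * sin theta) <= t * sin theta by rewrite ler_piMl ?(ltW ts)//; lra.
  have H0 : 0 <= s * (t * sin theta) by rewrite mulr_ge0 ?(ltW ts)//; lra.
  split; first by move: au; rewrite Ea; lra.
  rewrite profile_wall//; last by move: Ea; rewrite /a => ->; lra.
  by field; rewrite gt_eqF.
Qed.

Definition drop_area k u beta theta1 theta2 : R :=
  half_area k u beta theta1 theta2 + half_area k u beta theta2 theta1.

Lemma area_drop_interior k u beta theta1 theta2 : 0 < k -> u < 0 -> beta <= pi ->
  0 < theta1 < beta -> 0 < theta2 < beta -> theta1 + theta2 < pi ->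
  plane_area (enclosed (graphs_boundary (fun h => - profile k u beta theta1 theta2 h)
    (profile k u beta theta2 theta1) (apex k u beta theta1 theta2) u))
  = (drop_area k u beta theta1 theta2)%:E.
Proof.
move=> k0 u0 bpi th1 th2 th12.
have th21 : theta2 + theta1 < pi by rewrite addrC.
have aC := apexC k0 u0 bpi th1 th2 th12.
have c1 := continuous_profile k0 u0 bpi th1 th2 th12.
have c2 := continuous_profile k0 u0 bpi th2 th1 th21.
have c1N : continuous (fun h => - profile k u beta theta1 theta2 h).
  by move=> h; apply: cvgN; exact: c1.
have E1 : - profile k u beta theta1 theta2 (apex k u beta theta1 theta2) =
    profile k u beta theta2 theta1 (apex k u beta theta1 theta2).
  by rewrite profile_apex// -aC profile_apex// oppr0.
have E2 : - profile k u beta theta1 theta2 u = profile k u beta theta2 theta1 u.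
  by rewrite !profile_bottom// (offsetC k0 u0 bpi th1 th2 th12).
have H h : apex k u beta theta1 theta2 < h < u ->
    - profile k u beta theta1 theta2 h < profile k u beta theta2 theta1 h.
  by move=> hh; rewrite -subr_gt0 opprK addrC profileD_gt0.
rewrite enclosed_graphs_boundary ?apex_lt// area_graphs_interior//.
have fi (f : R -> R) x y : continuous f -> lebesgue_measure.-integrable `[x, y] (EFin \o f).
  move=> cf; apply: continuous_compact_integrable; first exact: segment_compact.
  exact: continuous_subspaceT.
have i1 := fi _ (apex k u beta theta1 theta2) u c1.
have i2 := fi _ (apex k u beta theta1 theta2) u c2.
under eq_integral do rewrite opprK EFinD.
rewrite integralD_EFin//.
have RE f : lebesgue_measure.-integrable `[apex k u beta theta1 theta2, u] (EFin \o f) ->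
   (\int[lebesgue_measure]_(x in `[apex k u beta theta1 theta2, u]) (f x)%:E)%E =
   (\int[lebesgue_measure]_(x in `[apex k u beta theta1 theta2, u]) f x)%:E.
  by move=> fi'; rewrite /Rintegral fineK//; exact: integrable_fin_num.
rewrite !RE// integral_profile// -aC integral_profile// -EFinD; congr (_%:E).
by rewrite /drop_area (offsetC k0 u0 bpi th1 th2 th12); ring.
Qed.

Lemma drop_boundaryE k u g gamma P0 theta1 theta2 (x y : R -> R) :
  let beta := gamma + pi / 2 in
  0 < k -> u < 0 -> beta <= pi ->
  0 < theta1 < beta -> 0 < theta2 < beta -> theta1 + theta2 < pi ->
  - P0 / g = apex k u beta theta1 theta2 ->
  (forall psi, - (beta - theta2) <= psi <= beta - theta1 ->
    x psi = - offset k u beta theta1 theta2 - abscissa k u psi /\ y psi = height k u psi) ->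
  drop_boundary g gamma theta1 theta2 P0 x y =
  graphs_boundary (fun h => - profile k u beta theta1 theta2 h)
    (profile k u beta theta2 theta1) (apex k u beta theta1 theta2) u.
Proof.
move=> beta k0 u0 bpi th1 th2 th12 EO Exy.
have th21 : theta2 + theta1 < pi by rewrite addrC.
have aC := apexC k0 u0 bpi th1 th2 th12.
have oC := offsetC k0 u0 bpi th1 th2 th12.
have G1 X h := profile_graphP X h k0 u0 bpi th1 th2 th12.
have G2 X h := profile_graphP X h k0 u0 bpi th2 th1 th21.
rewrite /drop_boundary /vertex EO.
have -> : psi_left gamma theta1 = beta - theta1 by [].
have -> : psi_right gamma theta2 = - (beta - theta2) by rewrite /psi_right /beta; ring.
have [E1x E1y] : x (beta - theta1) = - (wall_length k u beta theta1 theta2 * cos theta1)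
   /\ y (beta - theta1) = height k u (beta - theta1).
  by have [|-> ->] := Exy (beta - theta1); [lra|rewrite /offset; split=> //; ring].
have [E2x E2y] : x (- (beta - theta2)) = wall_length k u beta theta2 theta1 * cos theta2
   /\ y (- (beta - theta2)) = height k u (beta - theta2).
  have [|-> ->] := Exy (- (beta - theta2)); first by lra.
  by rewrite abscissaN// heightN -oC /offset; split=> //; ring.
apply/seteqP; split => -[X h].
- move=> [[|]|].
  + move=> [psi /=]; rewrite in_itv/= => psi0 [<- <-].
    have [-> ->] := Exy psi psi0.
    (* Nonnegative slopes belong to the left half, the reflected graph; negative ones are read at
       [- psi] on the right half. *)
    have [p0|p0] := leP 0 psi.
      have [] := (G1 (offset k u beta theta1 theta2 + abscissa k u psi) (height k u psi)).2.
        by left; exists psi => //; lra.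
      by move=> h1 h2; split => //=; left; rewrite -h2; ring.
    have [] := (G2 (offset k u beta theta2 theta1 + abscissa k u (- psi)) (height k u (- psi))).2.
      by left; exists (- psi) => //; lra.
    rewrite heightN abscissaN// aC => h1 h2; split => //=; right; rewrite -h2 oC; ring.
  + move=> [s /=]; rewrite in_itv/= E1x E1y => s0 [<- <-].
    have [] := (G1 (s * (wall_length k u beta theta1 theta2 * cos theta1))
      (apex k u beta theta1 theta2 + s * (wall_length k u beta theta1 theta2 * sin theta1))).2.
      by right; exists s.
    have -> : apex k u beta theta1 theta2 + s * (wall_length k u beta theta1 theta2 * sin theta1)
      = apex k u beta theta1 theta2 + s * (height k u (beta - theta1) - apex k u beta theta1 theta2).
      by rewrite /apex; ring.
    by move=> h1 h2; split => //=; left; rewrite -h2 add0r subr0 /GRing.scale/=; ring.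
  + move=> [s /=]; rewrite in_itv/= E2x E2y => s0 [<- <-].
    have [] := (G2 (s * (wall_length k u beta theta2 theta1 * cos theta2))
      (apex k u beta theta2 theta1 + s * (wall_length k u beta theta2 theta1 * sin theta2))).2.
      by right; exists s.
    have -> : apex k u beta theta2 theta1 + s * (wall_length k u beta theta2 theta1 * sin theta2)
      = apex k u beta theta2 theta1 + s * (height k u (beta - theta2) - apex k u beta theta2 theta1).
      by rewrite /apex; ring.
    by rewrite aC => h1 h2; split => //=; right; rewrite -h2 add0r subr0.
- move=> [/= hh [XE|XE]].
  + have [|[psi psi0 [HX Hh]]|[s s0 [HX Hh]]] := (G1 (- X) h).1.
      by split => //; rewrite XE opprK.
    * left; left; exists psi; first by rewrite /= in_itv/=; lra.
      have [|-> ->] := Exy psi; first by lra.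
      by rewrite Hh -[X]opprK HX; congr (_, _); ring.
    * left; right; exists s; first by rewrite /= in_itv.
      rewrite E1x E1y -[X]opprK HX Hh; congr (_, _); rewrite /= /GRing.scale/= ?/apex; ring.
  + have [|[psi psi0 [HX Hh]]|[s s0 [HX Hh]]] := (G2 X h).1.
      by rewrite aC.
    * left; left; exists (- psi); first by rewrite /= in_itv/=; lra.
      have [|-> ->] := Exy (- psi); first by lra.
      by rewrite Hh HX abscissaN// heightN oC; congr (_, _); ring.
    * right; exists s; first by rewrite /= in_itv.
      rewrite E2x E2y HX Hh -aC; congr (_, _); rewrite /= /GRing.scale/= ?/apex; ring.
Qed.

End DropRegion.

(** * Dependence of the area on the bottom height *)

Section AreaMonotone.
Context {R : realType}.
Implicit Types (k u v beta theta psi : R).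

(* A primitive of [support * radius], twice the area swept from the vertex. *)
Definition sector k u beta theta theta' psi : R :=
  - (offset k u beta theta theta' + abscissa k u psi) *
    (height k u psi + apex k u beta theta theta') - 2 * k * sin psi.

(* The last two terms are a primitive of the difference between the two mixed
   products of a support function and a radius; this cross product of the two
   curves vanishes at the contact points, which lie on parallel walls. *)
Definition mixed_sector k u v beta theta theta' psi : R :=
  sector k u beta theta theta' psi - sector k v beta theta theta' psi
  + (offset k u beta theta theta' + abscissa k u psi) *
    (height k v psi - apex k v beta theta theta')
  - (offset k v beta theta theta' + abscissa k v psi) *
    (height k u psi - apex k u beta theta theta').

Lemma is_derive_sector k u beta theta theta' psi : 0 < k -> u < 0 ->
  is_derive psi 1 (sector k u beta theta theta')
    (support k u beta theta theta' psi * radius k u psi).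
Proof.
move=> k0 u0.
have dA := is_derive1_fctD (is_derive1_fct_cst (offset k u beta theta theta') psi)
  (is_derive_abscissa k0 u0 psi).
have dH := is_derive1_fctD (is_derive_height k0 u0 psi)
  (is_derive1_fct_cst (apex k u beta theta theta') psi).
have d := is_derive1_fctB (is_derive1_fctM (is_derive1_fctN dA) dH)
  (is_derive1_fctM (is_derive1_fct_cst (2 * k) psi) (is_derive_sin psi)).
apply: (is_derive_eq d); rewrite /support.
(* Eliminating [k] through [radius * height = - k] leaves a polynomial identity. *)
have -> : 2 * k = - 2 * (radius k u psi * height k u psi) by rewrite radiusM_height//; ring.
by ring.
Qed.

Lemma is_derive_mixed_sector k u v beta theta theta' psi : 0 < k -> u < 0 -> v < 0 ->
  is_derive psi 1 (mixed_sector k u v beta theta theta')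
    ((support k u beta theta theta' psi + support k v beta theta theta' psi) *
     (radius k u psi - radius k v psi)).
Proof.
move=> k0 u0 v0.
have dA w (w0 : w < 0) := is_derive1_fctD (is_derive1_fct_cst (offset k w beta theta theta') psi)
  (is_derive_abscissa k0 w0 psi).
have dH w (w0 : w < 0) := is_derive1_fctB (is_derive_height k0 w0 psi)
  (is_derive1_fct_cst (apex k w beta theta theta') psi).
have d := is_derive1_fctB (is_derive1_fctD (is_derive1_fctB
   (is_derive_sector beta theta theta' psi k0 u0) (is_derive_sector beta theta theta' psi k0 v0))
   (is_derive1_fctM (dA u u0) (dH v v0))) (is_derive1_fctM (dA v v0) (dH u u0)).
by apply: (is_derive_eq d); rewrite /support; ring.
Qed.

Lemma sector_contact k u beta theta theta' :
  sector k u beta theta theta' (beta - theta) = 2 * half_area k u beta theta theta'.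
Proof. by rewrite /sector /half_area /offset /apex; field. Qed.

Lemma mixed_sector_contact k u v beta theta theta' :
  mixed_sector k u v beta theta theta' (beta - theta) =
  2 * (half_area k u beta theta theta' - half_area k v beta theta theta').
Proof. by rewrite /mixed_sector !sector_contact /offset /apex; ring. Qed.

Section TwoWalls.
Context {k beta theta1 theta2 : R} (k0 : 0 < k) (beta_pi : beta <= pi).
Context (th1 : 0 < theta1 < beta) (th2 : 0 < theta2 < beta) (th12 : theta1 + theta2 < pi).

Let th21 : theta2 + theta1 < pi. Proof. by rewrite addrC. Qed.

Local Notation area u := (drop_area k u beta theta1 theta2).
Local Notation a1 := (beta - theta1).
Local Notation a2 := (beta - theta2).

(** At slope 0 [sector] equals [- offset * (u + apex)], which is opposite for the two halves, so
    only the contact values survive. *)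
Lemma drop_areaE u : u < 0 -> area u =
  (sector k u beta theta1 theta2 a1 - sector k u beta theta1 theta2 0 +
   (sector k u beta theta2 theta1 a2 - sector k u beta theta2 theta1 0)) / 2.
Proof.
move=> u0; rewrite /drop_area !sector_contact /sector abscissa0// sin0.
by rewrite (offsetC k0 u0 beta_pi th1 th2 th12) (apexC k0 u0 beta_pi th1 th2 th12); field.
Qed.

Lemma drop_areaB u v : u < 0 -> v < 0 -> area u - area v =
  (mixed_sector k u v beta theta1 theta2 a1 - mixed_sector k u v beta theta1 theta2 0 +
   (mixed_sector k u v beta theta2 theta1 a2 - mixed_sector k u v beta theta2 theta1 0)) / 2.
Proof.
move=> u0 v0; rewrite /drop_area !mixed_sector_contact /mixed_sector /sector !abscissa0// sin0.
rewrite (offsetC k0 u0 beta_pi th1 th2 th12) (apexC k0 u0 beta_pi th1 th2 th12).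
by rewrite (offsetC k0 v0 beta_pi th1 th2 th12) (apexC k0 v0 beta_pi th1 th2 th12); field.
Qed.

Let mixed_sector_incr u v theta theta' x y : v < u -> u < 0 ->
  0 < theta < beta -> 0 < theta' < beta -> theta + theta' < pi ->
  0 <= x -> x < y -> y <= beta - theta ->
  mixed_sector k u v beta theta theta' x < mixed_sector k u v beta theta theta' y.
Proof.
move=> vu u0 th0 th0' thth x0 xy ya; have v0 : v < 0 by exact: lt_trans u0.
apply: (lt_is_derive_gt0 xy (fun s _ => is_derive_mixed_sector beta theta theta' s k0 u0 v0)) => s sxy.
have ss : 0 <= s < beta - theta by lra.
have S w (w0 : w < 0) := support_gt0 k0 w0 beta_pi th0 th0' thth ss.
by apply: mulr_gt0; [apply: addr_gt0; exact: S|rewrite subr_gt0; exact: radius_lt_left].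
Qed.

Lemma drop_area_incr u v : v < u -> u < 0 -> area v < area u.
Proof.
move=> vu u0; have v0 : v < 0 by exact: lt_trans u0.
rewrite -subr_gt0 drop_areaB// divr_gt0// addr_gt0// subr_gt0; apply: mixed_sector_incr => //.
  by move: th1 => ?; lra.
by move: th2 => ?; lra.
Qed.

(** The radicand is at most [u ^ 2 + k * psi ^ 2], hence at most the square of [- u + sqrt k * psi].
    The primitive of this bound is a logarithm, unbounded as [u] tends to 0. *)
Lemma radius_ge u psi : u < 0 -> 0 <= psi -> k / (- u + Num.sqrt k * psi) <= radius k u psi.
Proof.
move=> u0 psi0.
have s0 : 0 < Num.sqrt k by rewrite sqrtr_gt0.
have p0 : 0 < - u + Num.sqrt k * psi by rewrite ltr_wpDr ?oppr_gt0// mulr_ge0// ltW.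
rewrite /radius ler_pM2l// lef_pV2 ?posrE// ?oppr_gt0 ?height_lt0//.
rewrite /height opprK -[leRHS]gtr0_norm// -sqrtr_sqr ler_wsqrtr//.
have := one_subr_cos_le psi0; rewrite -(ler_pM2l k0) => H.
have E : Num.sqrt k * Num.sqrt k = k by rewrite -expr2 sqr_sqrtr// ltW.
have -> : (- u + Num.sqrt k * psi) ^+ 2 = u ^+ 2 + 2 * (- u * (Num.sqrt k * psi)) + k * psi ^+ 2.
  by rewrite -[X in _ + X * _]E; ring.
have : 0 <= - u * (Num.sqrt k * psi) by rewrite mulr_ge0 ?mulr_ge0//; lra.
by lra.
Qed.

Lemma radius_le u psi : u < 0 -> radius k u psi <= k / - u.
Proof.
move=> u0; rewrite /radius ler_pM2l// lef_pV2 ?posrE ?oppr_gt0 ?height_lt0//.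
by rewrite lerN2 height_le.
Qed.

Lemma continuous_support u theta theta' : u < 0 -> continuous (support k u beta theta theta').
Proof.
move=> u0 psi; apply: cvgD; apply: cvgM; [|exact: continuous_sin| |exact: continuous_cos].
  by apply: cvgD; [exact: cvg_cst|exact: is_derive1_continuous (is_derive_abscissa k0 u0 psi)].
by apply: cvgB; [exact: is_derive1_continuous (is_derive_height k0 u0 psi)|exact: cvg_cst].
Qed.

(** Comparison with the drop of height [-1], whose radius is at most [k] and whose support function
    is at least [c], half its value at 0, on a short arc [[0, d]]. There the derivative of
    [mixed_sector] is at least [c * (k / (- u + sqrt k * psi) - k)]; the other arcs contribute
    positively. *)
Lemma drop_area_ge_ln : exists2 C : R, 0 < C & exists D : R, forall u, -1 < u < 0 ->
  D - C * ln (- u) <= area u.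
Proof.
have v0 : (-1 : R) < 0 by lra.
pose c := support k (-1) beta theta1 theta2 0 / 2.
have c0 : 0 < c.
  by rewrite divr_gt0//; apply: support_gt0 => //; move: th1 => ?; lra.
have [d /andP[d0 da] Hd] : exists2 d, 0 < d < a1 & forall psi, 0 <= psi <= d ->
    c <= support k (-1) beta theta1 theta2 psi.
  have : \forall psi \near (0 : R), c < support k (-1) beta theta1 theta2 psi.
    have H : c < support k (-1) beta theta1 theta2 0.
      by move: c0; rewrite /c; lra.
    exact: (cvgr_gt _ (@continuous_support _ theta1 theta2 v0 0) _ H).
  move=> [/= e e0 He].
  have a0 : 0 < a1 by move: th1 => ?; lra.
  exists (Num.min (e / 2) (a1 / 2)).
    rewrite lt_min gt_min !divr_gt0//=; apply/orP; right; lra.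
  move=> psi /andP[p0]; rewrite le_min => /andP[pe _].
  by apply/ltW/He; rewrite /= sub0r normrN ger0_norm//; lra.
have s0 : 0 < Num.sqrt k by rewrite sqrtr_gt0.
(* Half the integral of that bound over [[0, d]], with [ln (- u + sqrt k * d)] replaced by the
   smaller [ln (sqrt k * d)]. *)
exists (c * Num.sqrt k / 2); first by rewrite divr_gt0// mulr_gt0.
exists (area (-1) + c * (Num.sqrt k * ln (Num.sqrt k * d) - k * d) / 2) => u /andP[u1 u0].
have uN : 0 < - u by lra.
pose m := mixed_sector k u (-1) beta theta1 theta2.
pose s := Num.sqrt k.
have dm (x : R) : 0 <= x -> is_derive x 1 (fun x => m x - c * (s * ln (- u + s * x) - k * x))
  ((support k u beta theta1 theta2 x + support k (-1) beta theta1 theta2 x) *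
     (radius k u x - radius k (-1) x) - c * (k / (- u + s * x) - k)).
  move=> x0; have p0 : 0 < - u + s * x by rewrite ltr_wpDr// mulr_ge0// ltW.
  have d1 := is_derive1_fctD (is_derive1_fct_cst (- u) x)
    (is_derive1_fctM (is_derive1_fct_cst s x) (is_derive1_fct_id x)).
  have d2 := is_derive1_fctM (is_derive1_fct_cst s x) (is_derive1_fct_comp d1 (is_derive1_ln p0)).
  have d3 := is_derive1_fctB (is_derive_mixed_sector beta theta1 theta2 x k0 u0 v0)
    (is_derive1_fctM (is_derive1_fct_cst c x)
    (is_derive1_fctB d2 (is_derive1_fctM (is_derive1_fct_cst k x) (is_derive1_fct_id x)))).
  apply: (is_derive_eq d3).
  have E : k = s * s by rewrite -expr2 sqr_sqrtr// ltW.
  have -> : k / (- u + s * x) = s * s / (- u + s * x) by rewrite -E.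
  have nz : - u + s * x != 0 by rewrite gt_eqF.
  by field.
have H1 : c * (s * (ln (- u + s * d) - ln (- u)) - k * d) <= m d - m 0.
  have dm' (x : R) : 0 <= x <= d -> _ := fun h => dm x (andP h).1.
  have := le_is_derive_ge0 (ltW d0) dm'.
  rewrite mulr0 addr0 mulr0 subr0 => H.
  suff : m 0 - c * (s * ln (- u)) <= m d - c * (s * ln (- u + s * d) - k * d) by lra.
  apply: H => x /andP[x0 xd]; rewrite subr_ge0.
  have hx : 0 <= x < a1 by rewrite (ltW x0) (lt_trans xd).
  have su := support_gt0 k0 u0 beta_pi th1 th2 th12 hx.
  have sv : c <= support k (-1) beta theta1 theta2 x by apply: Hd; rewrite !ltW.
  have ru := radius_ge u0 (ltW x0).
  have rv : radius k (-1) x <= k by have := radius_le x v0; rewrite opprK divr1.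
  have ruv := ltW (radius_lt_left x k0 u1 u0).
  apply: (@le_trans _ _ (c * (radius k u x - radius k (-1) x))).
    by rewrite ler_wpM2l ?(ltW c0)// lerB.
  by apply: ler_wpM2r; [rewrite subr_ge0|lra].
have H2 : m d < m a1 by apply: mixed_sector_incr => //; exact: ltW.
have H3 : mixed_sector k u (-1) beta theta2 theta1 0 < mixed_sector k u (-1) beta theta2 theta1 a2.
  by apply: mixed_sector_incr => //; move: th2 => ?; lra.
have := drop_areaB u0 v0; rewrite -/m.
have : ln (s * d) <= ln (- u + s * d).
  have sd := mulr_gt0 s0 d0.
  by rewrite ler_ln ?posrE ?addr_gt0// lerDr ltW.
rewrite -(ler_pM2l (mulr_gt0 c0 s0)) -/s; move: H1 H2 H3.
by lra.
Qed.

(** As the radius is at most [k / - u], both coordinates stay within [K = k * pi / - u] of those of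
    the point of slope 0. The support function depends on differences of heights only, so [u] itself
    cancels. *)
Let support_le theta theta' : 0 < theta < beta -> 0 < theta' < beta -> theta + theta' < pi ->
  exists2 H : R, 0 < H & forall u psi, u < 0 -> 0 <= psi <= pi ->
    `|support k u beta theta theta' psi| <= H / - u.
Proof.
move=> th0 th0' thth.
have sthth : 0 < sin (theta + theta') by rewrite sin_gt0_pi//; lra.
have Xle u psi : u < 0 -> 0 <= psi <= pi -> `|abscissa k u psi| <= k * pi / - u.
  move=> u0 /andP[p0 ppi]; rewrite -[abscissa _ _ _]subr0 -(abscissa0 k0 u0).
  apply: (le_trans (norm_is_derive_le (M := k / - u) p0 (fun s _ => is_derive_abscissa k0 u0 s) _)).
    move=> x _; rewrite normrM (gtr0_norm (radius_gt0 k0 u0 x)).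
    by rewrite (le_trans _ (radius_le x u0))// ler_piMr ?(ltW (radius_gt0 k0 u0 x))// ler_norml cos_geN1 cos_le1.
  by rewrite subr0 mulrAC ler_pM2r ?invr_gt0; [|lra]; rewrite ler_wpM2l// ltW.
have Yle u psi : u < 0 -> 0 <= psi <= pi -> `|height k u psi - u| <= k * pi / - u.
  move=> u0 /andP[p0 ppi]; rewrite -[X in _ - X](height0 u0 (k := k)).
  apply: (le_trans (norm_is_derive_le (M := k / - u) p0 (fun s _ => is_derive_height k0 u0 s) _)).
    move=> x _; rewrite normrN normrM (gtr0_norm (radius_gt0 k0 u0 x)).
    by rewrite (le_trans _ (radius_le x u0))// ler_piMr ?(ltW (radius_gt0 k0 u0 x))// ler_norml sin_geN1 sin_le1.
  by rewrite subr0 mulrAC ler_pM2r ?invr_gt0; [|lra]; rewrite ler_wpM2l// ltW.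
(* The numerator of the wall length consists of four terms bounded by [K]; the wall length enters
   the support function twice, next to four more terms bounded by [K]. *)
exists ((8 / sin (theta + theta') + 4) * (k * pi)).
  by rewrite !mulr_gt0 ?pi_gt0// addr_gt0// divr_gt0.
move=> u psi u0 psi0; set K := k * pi / - u.
have nle (x y : R) : `|y| <= 1 -> `|x * y| <= `|x| by move=> y1; rewrite normrM ler_piMr.
have nsin (x : R) : `|sin x| <= 1 by rewrite ler_norml sin_geN1 sin_le1.
have ncos (x : R) : `|cos x| <= 1 by rewrite ler_norml cos_geN1 cos_le1.
have a0 : 0 <= beta - theta <= pi by move: (beta_pi) => ?; lra.
have a0' : 0 <= beta - theta' <= pi by move: (beta_pi) => ?; lra.
set t := wall_length k u beta theta theta'.
have tle : `|t| <= 4 * K / sin (theta + theta').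
  rewrite /t /wall_length normrM (gtr0_norm (x := _^-1)) ?invr_gt0// ler_pM2r ?invr_gt0//.
  rewrite /tilt abscissaN// heightN//.
  have -> : sin theta' * abscissa k u (beta - theta) + cos theta' * height k u (beta - theta) -
      (sin theta' * - abscissa k u (beta - theta') + cos theta' * height k u (beta - theta')) =
      abscissa k u (beta - theta) * sin theta' + abscissa k u (beta - theta') * sin theta' +
      ((height k u (beta - theta) - u) * cos theta' - (height k u (beta - theta') - u) * cos theta').
    by ring.
  have -> : 4 * K = K + K + (K + K) by ring.
  rewrite (le_trans (ler_normD _ _))// lerD// (le_trans (ler_normD _ _))// lerD// ?normrN.
  - by rewrite (le_trans (nle _ _ (nsin _)))// Xle.
  - by rewrite (le_trans (nle _ _ (nsin _)))// Xle.
  - by rewrite (le_trans (nle _ _ (ncos _)))// Yle.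
  - by rewrite (le_trans (nle _ _ (ncos _)))// Yle.
have -> : support k u beta theta theta' psi =
    (t * cos theta - abscissa k u (beta - theta)) * sin psi + abscissa k u psi * sin psi +
    ((height k u psi - u) * cos psi - (height k u (beta - theta) - u - t * sin theta) * cos psi).
  by rewrite /support /offset /apex -/t; ring.
have -> : (8 / sin (theta + theta') + 4) * (k * pi) / - u =
   4 * K / sin (theta + theta') + K + K + (K + (K + 4 * K / sin (theta + theta'))).
  by rewrite /K; field; rewrite (gt_eqF sthth) (lt_eqF u0).
rewrite (le_trans (ler_normD _ _))// lerD// (le_trans (ler_normD _ _))// lerD// ?normrN.
- rewrite (le_trans (nle _ _ (nsin _)))// (le_trans (ler_normD _ _))// lerD// ?normrN ?Xle//.
  by rewrite (le_trans (nle _ _ (ncos _))).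
- by rewrite (le_trans (nle _ _ (nsin _)))// Xle.
- by rewrite (le_trans (nle _ _ (ncos _)))// Yle.
- rewrite (le_trans (nle _ _ (ncos _)))// (le_trans (ler_normD _ _))// lerD// ?normrN ?Yle//.
  by rewrite (le_trans (nle _ _ (nsin _))).
Qed.

Let norm_half (x y z : R) : `|x| <= z -> `|y| <= z -> `|(x + y) / 2| <= z.
Proof. by rewrite !ler_norml => /andP[? ?] /andP[? ?]; apply/andP; split; lra. Qed.

Lemma drop_area_le : exists2 M : R, 0 < M & forall u, u < 0 -> `|area u| <= M / u ^+ 2.
Proof.
have [H1 H10 HH1] := support_le th1 th2 th12.
have [H2 H20 HH2] := support_le th2 th1 th21.
exists (Num.max H1 H2 * k * pi); first by rewrite !mulr_gt0 ?pi_gt0// lt_max H10.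
move=> u u0; rewrite drop_areaE//.
have half theta theta' H : 0 < theta < beta -> 0 < H -> H <= Num.max H1 H2 ->
    (forall u psi, u < 0 -> 0 <= psi <= pi -> `|support k u beta theta theta' psi| <= H / - u) ->
    `|sector k u beta theta theta' (beta - theta) - sector k u beta theta theta' 0| <=
    Num.max H1 H2 * k * pi / u ^+ 2.
  move=> th0 H0 HM HH; have a0 : 0 <= beta - theta by lra.
  have api : beta - theta <= pi by move: (beta_pi) => ?; lra.
  have uN : 0 < - u by lra.
  apply: (le_trans (norm_is_derive_le (M := Num.max H1 H2 * k / u ^+ 2) a0
    (fun s _ => is_derive_sector beta theta theta' s k0 u0) _)); last first.
    rewrite subr0 [leRHS]mulrAC ler_wpM2l// divr_ge0 ?sqr_ge0//.
    by rewrite mulr_ge0 ?(ltW k0)// (le_trans _ HM)// ltW.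
  move=> x x0; rewrite normrM (gtr0_norm (radius_gt0 k0 u0 x)).
  have -> : Num.max H1 H2 * k / u ^+ 2 = Num.max H1 H2 / - u * (k / - u).
    by field; rewrite (lt_eqF u0).
  apply: ler_pM => //; first exact/ltW/radius_gt0.
    apply: (le_trans (HH _ _ u0 _)); first by lra.
    by rewrite ler_pM2r ?invr_gt0.
  exact: radius_le.
by apply: norm_half; [apply: half HH1|apply: half HH2] => //; rewrite le_max lexx ?orbT.
Qed.

(** Since [height ^ 2 - u ^ 2] does not depend on [u], the heights [p], [q] satisfy [(p - q) * (- p
    - q) = (u - v) * (- u - v)]. They lie at least as far from 0 as [u] and [v], so they differ by
    no more than [u] and [v] do, and [p * q >= b ^ 2]. *)
Let radius_lipschitz b u v psi : b < 0 -> u <= b -> v <= b ->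
  `|radius k u psi - radius k v psi| <= k / b ^+ 2 * `|u - v|.
Proof.
move=> b0 ub vb; wlog uv : u v ub vb / v <= u => [W|].
  have [/W->//|/ltW/W H] := leP v u.
  by rewrite distrC (distrC u v); exact: H.
have u0 : u < 0 by lra. have v0 : v < 0 by lra.
have hu := height_le k0 u0 psi; have hv := height_le k0 v0 psi.
have su := sqr_height k0 u0 psi; have sv := sqr_height k0 v0 psi.
rewrite /radius; move: (height k u psi) (height k v psi) hu hv su sv => p q pu qv su sv.
have E : k / - p - k / - q = k * (p - q) / (p * q).
  by field; rewrite !lt_eqF//; lra.
have pq : q <= p.
  rewrite leNgt; apply/negP => pq; move: su sv; rewrite !expr2 => su' sv'.
  have h1 : q * q < p * p by nra.
  have h2 : u * u <= v * v by nra.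
  by lra.
have pqu : p - q <= u - v.
  have H : (p - q) * (- p - q) = (u - v) * (- u - v).
    have -> : (p - q) * (- p - q) = q ^+ 2 - p ^+ 2 by ring.
    by rewrite su sv; ring.
  have H2 : (u - v) * (- u - v) <= (u - v) * (- p - q).
    by apply: ler_wpM2l; lra.
  rewrite -(ler_pM2r (x := - p - q)); last by lra.
  by rewrite H.
have pq0 : 0 < p * q by rewrite nmulr_rgt0; lra.
have bpq : b ^+ 2 <= p * q by rewrite expr2; nra.
rewrite E (ger0_norm (x := u - v)) ?subr_ge0// ger0_norm; last first.
  by apply: divr_ge0; [apply: mulr_ge0; [exact: ltW|rewrite subr_ge0]|exact: ltW].
rewrite -mulrA [leRHS]mulrAC -[leRHS]mulrA ler_pM2l//.
apply: ler_pM; rewrite ?subr_ge0// ?invr_ge0 ?(ltW pq0)//.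
by rewrite lef_pV2 ?posrE// exprn_even_gt0//= lt_eqF.
Qed.

Lemma drop_area_lipschitz b : b < 0 -> exists2 L : R, 0 < L &
  forall u v, u <= b -> v <= b -> `|area u - area v| <= L * `|u - v|.
Proof.
move=> b0.
have [H1 H10 HH1] := support_le th1 th2 th12.
have [H2 H20 HH2] := support_le th2 th1 th21.
pose L := (Num.max H1 H2 / - b + Num.max H1 H2 / - b) * (k / b ^+ 2).
have bN : 0 < - b by lra.
have b2 : 0 < b ^+ 2 by rewrite exprn_even_gt0//= lt_eqF.
have M0 : 0 < Num.max H1 H2 by rewrite lt_max H10.
have L0 : 0 < L by rewrite mulr_gt0 ?addr_gt0 ?divr_gt0.
exists (L * pi); first by rewrite mulr_gt0 ?pi_gt0.
move=> u v ub vb; have u0 : u < 0 by lra. have v0 : v < 0 by lra.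
rewrite drop_areaB//.
have half theta theta' H : 0 < theta < beta -> 0 < H -> H <= Num.max H1 H2 ->
    (forall u psi, u < 0 -> 0 <= psi <= pi -> `|support k u beta theta theta' psi| <= H / - u) ->
    `|mixed_sector k u v beta theta theta' (beta - theta) - mixed_sector k u v beta theta theta' 0| <=
    L * pi * `|u - v|.
  move=> th0 H0 HM HH; have a0 : 0 <= beta - theta by lra.
  have api : beta - theta <= pi by move: (beta_pi) => ?; lra.
  have HHb w psi : w <= b -> 0 <= psi <= pi -> `|support k w beta theta theta' psi| <= Num.max H1 H2 / - b.
    move=> wb p0; have w0 : w < 0 by lra.
    apply: (le_trans (HH _ _ w0 p0)); apply: ler_pM => //; rewrite ?(ltW H0)// ?invr_ge0; first by lra.
    by rewrite lef_pV2 ?posrE ?lerN2//; lra.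
  apply: (le_trans (norm_is_derive_le (M := L * `|u - v|) a0
    (fun s _ => is_derive_mixed_sector beta theta theta' s k0 u0 v0) _)); last first.
    by rewrite subr0 [leRHS]mulrAC ler_wpM2l// mulr_ge0// ltW.
  move=> x x0; rewrite normrM /L -mulrA; apply: ler_pM => //; last exact: radius_lipschitz.
  by rewrite (le_trans (ler_normD _ _))// lerD// HHb//; lra.
by apply: norm_half; [apply: half HH1|apply: half HH2] => //; rewrite le_max lexx ?orbT.
Qed.

End TwoWalls.
End AreaMonotone.

(** * From capillary drops to the explicit solution *)

Section Solutions.
Context {R : realType}.
Implicit Types (g sigma u psi : R).

Let ratio_gt0 g sigma : 0 < g -> 0 < sigma -> 0 < sigma / g.
Proof. by move=> ? ?; rewrite divr_gt0. Qed.

Let rhs_height g sigma u psi c : 0 < g -> 0 < sigma -> u < 0 ->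
  sigma * c / (g * height (sigma / g) u psi) = - (radius (sigma / g) u psi * c).
Proof.
move=> g0 s0 u0; have h0 := height_neq0 (ratio_gt0 g0 s0) u0 psi.
rewrite /radius; move: (height _ _ _) h0 => h h0.
by field; rewrite h0 gt_eqF.
Qed.

Lemma capillary_solution_unique g sigma psi1 psi2 xm u (x y : R -> R) :
  0 < g -> 0 < sigma -> u < 0 -> 0 < psi1 -> psi2 < 0 ->
  capillary_solution g sigma psi1 psi2 xm u x y ->
  forall psi, psi2 <= psi <= psi1 ->
    x psi = xm - abscissa (sigma / g) u psi /\ y psi = height (sigma / g) u psi.
Proof.
move=> g0 s0 u0 p1 p2 [cx cy dxy x0 [y0 yu]].
have k0 := ratio_gt0 g0 s0; set k := sigma / g in k0 *.
(* Where no supremum exists [sup] takes the default value 0, which contradicts [u < 0]. *)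
have ysup : has_sup [set y psi | psi in `[psi2, psi1]].
  apply: contrapT => /sup_out E; move: u0; rewrite yu E ltxx //.
have yle psi : psi2 <= psi <= psi1 -> y psi <= u.
  by move=> pp; rewrite yu; apply: sup_upper_bound => //; exists psi => //=; rewrite in_itv.
have in0 : psi2 <= 0 <= psi1 by rewrite !ltW.
have ysq psi : psi2 <= psi <= psi1 -> y psi * y psi + 2 * k * cos psi = u ^+ 2 + 2 * k.
  move=> pp; pose f s := y s * y s + 2 * k * cos s.
  have -> : u ^+ 2 + 2 * k = f 0 by rewrite /f y0 cos0 mulr1 expr2.
  apply: (@is_derive_within_cst _ f psi2 psi1) => //.
    move=> s; apply: cvgD; first by apply: cvgM; exact: cy.
    apply: cvgM; first exact: cvg_cst.
    by apply: continuous_subspaceT; exact: continuous_cos.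
  move=> s ss; have [_ dy] := dxy s ss.
  have d := is_derive1_fctD (is_derive1_fctM dy dy)
    (is_derive1_fctM (is_derive1_fct_cst (2 * k) s) (is_derive_cos s)).
  apply: (is_derive_eq d).
  have ys : y s != 0.
    have : y s <= u by apply: yle; rewrite !ltW; case/andP: ss.
    by move=> ?; rewrite lt_eqF//; lra.
  by rewrite /k; field; rewrite ys gt_eqF.
have yE psi : psi2 <= psi <= psi1 -> y psi = height k u psi.
  move=> pp; have := ysq psi pp; have := sqr_height k0 u0 psi.
  have := height_lt0 k0 u0 psi; have := yle psi pp.
  move: (height k u psi) (y psi) => a b bu a0 sa sb.
  (* Both numbers are negative, so the second factor cannot vanish. *)
  have : (b - a) * (b + a) = 0.
    have -> : (b - a) * (b + a) = b * b - a ^+ 2 by ring.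
    by rewrite sa; lra.
  by move/eqP; rewrite mulf_eq0 => /orP[/eqP|/eqP]; lra.
move=> psi pp; split; last exact: yE.
suff : x psi + abscissa k u psi = x 0 + abscissa k u 0.
  by rewrite x0 abscissa0// => ?; lra.
apply: (@is_derive_within_cst _ (fun s => x s + abscissa k u s) psi2 psi1) => //.
  move=> s; apply: cvgD; first exact: cx.
  apply: continuous_subspaceT => t; exact: is_derive1_continuous (is_derive_abscissa k0 u0 t).
move=> s ss; have [dx _] := dxy s ss.
have ss' : psi2 <= s <= psi1 by rewrite !ltW; case/andP: ss.
move: dx; rewrite yE// rhs_height// => dx.
apply: (is_derive_eq (is_derive1_fctD dx (is_derive_abscissa k0 u0 s))).
by rewrite addNr.
Qed.

Lemma capillary_solution_exists g sigma psi1 psi2 xm u :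
  0 < g -> 0 < sigma -> u < 0 -> 0 < psi1 -> psi2 < 0 ->
  capillary_solution g sigma psi1 psi2 xm u
    (fun psi => xm - abscissa (sigma / g) u psi) (height (sigma / g) u).
Proof.
move=> g0 s0 u0 p1 p2; have k0 := ratio_gt0 g0 s0.
have dX psi : is_derive psi 1 (fun psi => xm - abscissa (sigma / g) u psi)
    (- (radius (sigma / g) u psi * cos psi)).
  by rewrite -[X in is_derive _ _ _ X]add0r; exact: (is_derive1_fctB (is_derive1_fct_cst xm psi) (is_derive_abscissa k0 u0 psi)).
split.
- by apply: continuous_subspaceT => psi; exact: is_derive1_continuous (dX psi).
- by apply: continuous_subspaceT => psi; exact: is_derive1_continuous (is_derive_height k0 u0 psi).
- by move=> psi _; rewrite !rhs_height//; split; [exact: dX|exact: is_derive_height].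
- by rewrite abscissa0// subr0.
split; first exact: height0.
apply/eqP; rewrite eq_le; apply/andP; split.
  rewrite -[leLHS](height0 u0 (k := sigma / g)); apply: ub_le_sup.
    by exists u => _ [psi _ <-]; exact: height_le.
  by exists 0 => //=; rewrite in_itv/= !ltW.
apply: ge_sup; last by move=> _ [psi _ <-]; exact: height_le.
by exists (height (sigma / g) u 0), 0 => //=; rewrite in_itv/= !ltW.
Qed.

Context {g sigma theta1 theta2 gamma : R} (g0 : 0 < g) (s0 : 0 < sigma).
Local Notation beta := (gamma + pi / 2).
Local Notation k := (sigma / g).
Context (beta_pi : beta <= pi).
Context (th1 : 0 < theta1 < beta) (th2 : 0 < theta2 < beta) (th12 : theta1 + theta2 < pi).

Let psi_rightE : psi_right gamma theta2 = - (beta - theta2).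
Proof. by rewrite /psi_right; ring. Qed.

Lemma capillary_dropP xm u P0 (x y : R -> R) :
  capillary_drop g sigma gamma theta1 theta2 xm u P0 x y ->
  [/\ u < 0, xm = - offset k u beta theta1 theta2, - P0 / g = apex k u beta theta1 theta2 &
    forall psi, psi_right gamma theta2 <= psi <= psi_left gamma theta1 ->
      x psi = - offset k u beta theta1 theta2 - abscissa k u psi /\ y psi = height k u psi].
Proof.
move=> [u0 sol [[s /= sI [Es1 Es2]] [s' /= sI' [Es1' Es2']]]].
have k0 := ratio_gt0 g0 s0.
have p1 : 0 < psi_left gamma theta1 by rewrite /psi_left; move: th1 => ?; lra.
have p2 : psi_right gamma theta2 < 0 by rewrite psi_rightE; move: th2 => ?; lra.
have U := capillary_solution_unique g0 s0 u0 p1 p2 sol.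
have [X1 Y1] := U (psi_left gamma theta1) ltac:(lra).
have [X2 Y2] := U (psi_right gamma theta2) ltac:(lra).
move: Es1 Es2 Es1' Es2'; rewrite X1 Y1 X2 Y2 psi_rightE abscissaN// heightN// /psi_left /GRing.scale/= => Es1 Es2 Es1' Es2'.
(* Subtracting the equations of the two contact points eliminates [xm] and the height of the vertex,
   leaving the linear system for the two wall parameters. *)
have [|| Es Es'] := wall_length_unique k0 u0 beta_pi th1 th2 th12 (s := s) (s' := s').
- by lra.
- by lra.
have xmE : xm = - offset k u beta theta1 theta2 by rewrite /offset -Es; lra.
split=> //; first by rewrite /apex -Es; lra.
by rewrite -xmE => psi pp; apply: U; rewrite psi_rightE.
Qed.

Lemma capillary_drop_exists u : u < 0 ->
  capillary_drop g sigma gamma theta1 theta2 (- offset k u beta theta1 theta2) u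
    (- (g * apex k u beta theta1 theta2))
    (fun psi => - offset k u beta theta1 theta2 - abscissa k u psi) (height k u).
Proof.
move=> u0; have k0 := ratio_gt0 g0 s0.
have p1 : 0 < psi_left gamma theta1 by rewrite /psi_left; move: th1 => ?; lra.
have p2 : psi_right gamma theta2 < 0 by rewrite psi_rightE; move: th2 => ?; lra.
have th21 : theta2 + theta1 < pi by rewrite addrC.
have vE : vertex g (- (g * apex k u beta theta1 theta2)) = (0, apex k u beta theta1 theta2).
  by rewrite /vertex opprK mulrAC mulfV ?mul1r// gt_eqF.
split; [exact: u0|exact: capillary_solution_exists|split].
- exists (wall_length k u beta theta1 theta2).
    by rewrite /= in_itv/= andbT ltW// wall_length_gt0.
  rewrite vE /psi_left; congr (_, _); rewrite /= /GRing.scale/= /offset ?/apex; ring.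
- exists (wall_length k u beta theta2 theta1).
    by rewrite /= in_itv/= andbT ltW// wall_length_gt0.
  rewrite vE psi_rightE abscissaN// heightN// -(offsetC k0 u0 beta_pi th1 th2 th12)
   -(apexC k0 u0 beta_pi th1 th2 th12); congr (_, _); rewrite /= /GRing.scale/= /offset ?/apex; ring.
Qed.

Lemma drop_volumeE xm u P0 (x y : R -> R) :
  capillary_drop g sigma gamma theta1 theta2 xm u P0 x y ->
  drop_volume g gamma theta1 theta2 P0 x y = (drop_area k u beta theta1 theta2)%:E.
Proof.
move=> /capillary_dropP[u0 _ OE Exy]; have k0 := ratio_gt0 g0 s0.
rewrite psi_rightE in Exy.
by rewrite /drop_volume (drop_boundaryE k0 u0 beta_pi th1 th2 th12 OE Exy) area_drop_interior.
Qed.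

End Solutions.

(** * Limits of the area, its continuity and its range *)

Section AreaLimits.
Context {R : realType} {k beta theta1 theta2 : R} (k0 : 0 < k) (beta_pi : beta <= pi).
Context (th1 : 0 < theta1 < beta) (th2 : 0 < theta2 < beta) (th12 : theta1 + theta2 < pi).

Local Notation area u := (drop_area k u beta theta1 theta2).

Lemma cvg_drop_area_at_left0 : area u @[u --> 0^'-] --> +oo.
Proof.
have [C C0 [D H]] := drop_area_ge_ln k0 beta_pi th1 th2 th12.
(* The bound [D - C * ln (- u) >= A] amounts to [- u <= expR ((D - A) / C)]; the [1] keeps [u] above
   [-1]. *)
apply/cvgryPge => A; pose e := Num.min 1 (expR ((D - A) / C)).
have e0 : 0 < e by rewrite lt_min ltr01 expR_gt0.
near=> u.
have u0 : u < 0 by near: u; exact: nbhs_left_lt.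
have eu : - e < u by near: u; apply: nbhs_left_gt; rewrite oppr_lt0.
have [u1 ule] : -1 < u /\ - u < expR ((D - A) / C).
  have : - u < e by lra.
  by rewrite lt_min => /andP[? ?]; split => //; lra.
apply: le_trans (H u _); last by rewrite u1.
have : ln (- u) <= (D - A) / C.
  rewrite -[leRHS]expRK ler_ln ?posrE ?expR_gt0 ?oppr_gt0//; exact: ltW.
by rewrite ler_pdivlMr//; lra.
Unshelve. all: by end_near. Qed.

Lemma cvg_drop_area_ninfty : area u @[u --> -oo] --> 0.
Proof.
have [M M0 H] := drop_area_le k0 beta_pi th1 th2 th12.
apply/cvgrPdist_le => e e0; near=> u.
(* Below [-1] one has [u ^ 2 > - u], so [- u > M / e] is enough. *)
have u1 : u < -1 by near: u; apply: nbhs_ninfty_lt; exact: num_real.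
have uM : u < - (M / e) by near: u; apply: nbhs_ninfty_lt; exact: num_real.
rewrite sub0r normrN; apply: le_trans (H u _) _; first by lra.
have u2 : 0 < u ^+ 2 by rewrite exprn_even_gt0//= lt_eqF//; lra.
rewrite ler_pdivrMr// mulrC -ler_pdivrMr//.
have Me : 0 < M / e by rewrite divr_gt0.
rewrite expr2; nra.
Unshelve. all: by end_near. Qed.

Lemma drop_area_continuous u : u < 0 -> {for u, continuous (fun u => area u)}.
Proof.
move=> u0; have b0 : u / 2 < 0 by lra.
have [L L0 H] := drop_area_lipschitz k0 beta_pi th1 th2 th12 b0.
apply/cvgrPdist_le => e e0; near=> v.
have vb : v < u / 2 by near: v; apply: lt_nbhsl; lra.
apply: (le_trans (H u v _ (ltW vb))); first by lra.
rewrite mulrC -ler_pdivlMr// ltW//; near: v.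
by exists (e / L) => //=; rewrite divr_gt0.
Unshelve. all: by end_near. Qed.

Lemma drop_area_onto (vol : R) : 0 < vol -> exists2 u, u < 0 & area u = vol.
Proof.
move=> vol0.
have /filter_ex[a [a0 avol]] : \forall a \near -oo, a < 0 /\ area a < vol.
  near=> a; split; first by near: a; apply: nbhs_ninfty_lt; exact: num_real.
  by near: a; exact: (cvgr_lt _ cvg_drop_area_ninfty _ vol0).
have /filter_ex[b [b0 bvol]] : \forall b \near 0^'-, b < 0 /\ vol <= area b.
  near=> b; split; first by near: b; exact: nbhs_left_lt.
  by near: b; move/cvgryPge : cvg_drop_area_at_left0; exact.
(* The two points come from separate limits; monotonicity of the area puts them in order. *)
have ab : a <= b.
  rewrite leNgt; apply/negP => ba.
  by have := drop_area_incr k0 beta_pi th1 th2 th12 ba a0; lra.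
have [||c] := @IVT _ (fun u => area u) a b vol ab.
- apply: continuous_in_subspaceT => u /set_mem/=; rewrite in_itv/= => /andP[_ ub].
  by apply: drop_area_continuous; lra.
- by rewrite ge_min (ltW avol)/= le_max bvol orbT.
- by rewrite in_itv/= => /andP[_ cb] E; exists c => //; lra.
Unshelve. all: by end_near. Qed.

End AreaLimits.

Theorem theorem1p2 (R : realType)
    (g sigma theta1 theta2 jump_gamma gamma : R)
    (g_gt0 : 0 < g) (sigma_gt0 : 0 < sigma)
    (theta1_range : 0 < theta1 < pi) (theta2_range : 0 < theta2 < pi)
    (theta_sum : theta1 + theta2 < pi)
    (jump_range : -1 <= jump_gamma / sigma <= 1)
    (gamma_range : - (pi / 2) <= gamma <= pi / 2)
    (sin_gamma : sin gamma = - (jump_gamma / sigma))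
    (psi1_gt0 : 0 < psi_left gamma theta1)
    (psi2_lt0 : psi_right gamma theta2 < 0) :
  exists V Oy : R -> R,
    [/\ (* V and Oy are the volume and the height of O as functions of um *)
        (forall um : R, um < 0 ->
          (exists (xm P0 : R) (x y : R -> R),
            capillary_drop g sigma gamma theta1 theta2 xm um P0 x y) /\
          (forall (xm P0 : R) (x y : R -> R),
            capillary_drop g sigma gamma theta1 theta2 xm um P0 x y ->
            drop_volume g gamma theta1 theta2 P0 x y = (V um)%:E /\
            - P0 / g = Oy um)),
        V um @[um --> 0^'-] --> +oo,
        V um @[um --> -oo] --> 0,
        (forall vol : R, 0 < vol ->
          exists (um xm P0 : R) (x y : R -> R),
            capillary_drop g sigma gamma theta1 theta2 xm um P0 x y /\
            drop_volume g gamma theta1 theta2 P0 x y = vol%:E)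
      & jump_gamma < 0 ->
        {in `]-oo, 0[ &, {homo V : um um' / um < um'}} /\
        (forall vol : R, 0 < vol ->
          forall (um xm P0 : R) (x y : R -> R)
                 (um' xm' P0' : R) (x' y' : R -> R),
            capillary_drop g sigma gamma theta1 theta2 xm um P0 x y ->
            drop_volume g gamma theta1 theta2 P0 x y = vol%:E ->
            capillary_drop g sigma gamma theta1 theta2 xm' um' P0' x' y' ->
            drop_volume g gamma theta1 theta2 P0' x' y' = vol%:E ->
            [/\ um = um', xm = xm', P0 = P0' &
                forall psi : R,
                  psi_right gamma theta2 <= psi <= psi_left gamma theta1 ->
                  x psi = x' psi /\ y psi = y' psi])].
Proof.
have k0 : 0 < sigma / g by rewrite divr_gt0.
set k := sigma / g in k0.
pose beta := gamma + pi / 2.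
have beta_pi : beta <= pi by rewrite /beta; lra.
(* The contact slopes are [beta - theta1] and [- (beta - theta2)], so their signs say that both wall
   angles are below [beta]. *)
have th1 : 0 < theta1 < beta by move: psi1_gt0; rewrite /psi_left /beta; lra.
have th2 : 0 < theta2 < beta by move: psi2_lt0; rewrite /psi_right /beta; lra.
exists (fun u => drop_area k u beta theta1 theta2), (fun u => apex k u beta theta1 theta2).
split.
- move=> um um0; split.
    do 4 eexists.
    exact: (capillary_drop_exists g_gt0 sigma_gt0 beta_pi th1 th2 theta_sum um0).
  move=> xm P0 x y drop; split.
    exact: (drop_volumeE g_gt0 sigma_gt0 beta_pi th1 th2 theta_sum drop).
  by have [] := capillary_dropP g_gt0 sigma_gt0 beta_pi th1 th2 theta_sum drop.
- exact: cvg_drop_area_at_left0.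
- exact: cvg_drop_area_ninfty.
- move=> vol vol0.
  have [um um0 E] := drop_area_onto k0 beta_pi th1 th2 theta_sum vol0.
  have drop := capillary_drop_exists g_gt0 sigma_gt0 beta_pi th1 th2 theta_sum um0.
  do 5 eexists; split; first exact: drop.
  by rewrite (drop_volumeE g_gt0 sigma_gt0 beta_pi th1 th2 theta_sum drop) -E.
- move=> _; split.
    move=> u v; rewrite !in_itv/= => u0 v0 uv.
    exact: (drop_area_incr k0 beta_pi th1 th2 theta_sum uv v0).
  move=> vol _ um xm P0 x y um' xm' P0' x' y' drop Edrop drop' Edrop'.
  have [u0 xmE OE Exy] := capillary_dropP g_gt0 sigma_gt0 beta_pi th1 th2 theta_sum drop.
  have [u0' xmE' OE' Exy'] := capillary_dropP g_gt0 sigma_gt0 beta_pi th1 th2 theta_sum drop'.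
  have uu : um = um'.
    move: Edrop; rewrite -Edrop'.
    rewrite (drop_volumeE g_gt0 sigma_gt0 beta_pi th1 th2 theta_sum drop).
    rewrite (drop_volumeE g_gt0 sigma_gt0 beta_pi th1 th2 theta_sum drop') => -[] E.
    have [lt|lt|//] := ltgtP um um'.
      by have := drop_area_incr k0 beta_pi th1 th2 theta_sum lt u0'; rewrite E ltxx.
    by have := drop_area_incr k0 beta_pi th1 th2 theta_sum lt u0; rewrite E ltxx.
  subst um'; split=> //; first by rewrite xmE.
    apply: oppr_inj; apply: (mulIf (x := g^-1)); first by rewrite invr_eq0 gt_eqF.
    by rewrite OE OE'.
  by move=> psi pp; have [-> ->] := Exy psi pp; have [-> ->] := Exy' psi pp.
Qed.
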